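(* Let $l\ge 2$, let $P_1\subseteq\mathbb{R}^{d_1},\ldots,P_l\subseteq\mathbb{R}^{d_l}$ be polytopes with nonempty relative interior, given by representations $P_i=\{x_i\in\mathbb{R}^{d_i} : a^{(i)}\ge A^{(i)}x_i,\ b^{(i)}=B^{(i)}x_i\}$ satisfying Assumption (A) of the context, and let $f(x_1,\ldots,x_l)$ be a multilinear function (in the sense of the context). Let $f^*=\max\{f(x_1,\ldots,x_l) : (x_1,\ldots,x_l)\in P_1\times\cdots\times P_l\}$, and for integers $t\ge l$ let $f_t=\inf\{\mu\in\mathbb{R} : \mu-f\in \mathrm{QM}_t+\mathrm{I}_t\}$, with $\mathrm{QM}$, $\mathrm{I}$, $\mathrm{QM}_t$, $\mathrm{I}_t$ as in the context. Then: (1) The sequence $(f_t)_{t\ge l}$ converges from above to $f^*$, i.e. $f_t\ge f^*$ for all $t\ge l$ and $\lim_{t\to\infty}f_t=f^*$. (2) If the problem of maximizing $f$ over $P_1\times\cdots\times P_l$ has only finitely many optimal solutions, then $f^*-f\in \mathrm{QM}+\mathrm{I}$. Thus the sequence $(f_t)_t$ converges to $f^*$ in finitely many steps, i.e. there is $t_0\ge l$ with $f_t=f^*$ for all $t\ge t_0$.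
   Context: Write $[l]=\{1,\ldots,l\}$ and $x_i=(x_{i,1},\ldots,x_{i,d_i})$; $\mathbb{R}[x]$ denotes the polynomial ring in all the variables $x=(x_1,\ldots,x_l)$. Multilinear function: a polynomial of the form $f=\sum_{\emptyset\neq L\subseteq[l]}Q^{(L)}(x_i : i\in L)$, where each $Q^{(L)}$ is a real tensor with one index of range $d_i$ for each $i\in L$, regarded as a form that is linear in each $x_i$, $i\in L$, and $Q^{([l])}\ne 0$. (Thus $f$ is affine in each block $x_i$ when the other blocks are fixed.) Polytopes: $a^{(i)}\in\mathbb{R}^{m_i}$, $A^{(i)}\in\mathbb{R}^{m_i\times d_i}$, $b^{(i)}\in\mathbb{R}^{n_i}$, $B^{(i)}\in\mathbb{R}^{n_i\times d_i}$, inequalities are componentwise, and $P_i$ is bounded. Put $\mathcal{B}_i=\{x\in\mathbb{R}^{d_i} : b^{(i)}=B^{(i)}x\}$. The relative interior of $P_i$ is taken with respect to the affine subspace $\mathcal{B}_i$. Assumption (A): for every $i\in[l]$, (i) the equality constraints are linearly independent, i.e. $\dim\mathcal{B}_i=d_i-n_i$, and $d_i-n_i>0$; (ii) $\{x\in\mathcal{B}_i : a^{(i)}\ge A^{(i)}x\}$ is full-dimensional in $\mathcal{B}_i$, i.e. has dimension $d_i-n_i$. Sums of squares: $\Sigma[x]\subseteq\mathbb{R}[x]$ is the set of sums of squares of polynomials; $\Sigma_{k}[x]$ and $\mathbb{R}_{k}[x]$ are the elements of $\Sigma[x]$, respectively $\mathbb{R}[x]$, of degree at most $k$. Define $$\mathrm{QM}=\Big\{\sigma_0+\sum_{i=1}^l\sum_{j=1}^{m_i}\sigma_{ij}(a^{(i)}-A^{(i)}x_i)_j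 : \sigma_0,\sigma_{ij}\in\Sigma[x]\Big\},\quad \mathrm{I}=\Big\{\sum_{i=1}^l\sum_{j=1}^{n_i}\tau_{ij}(b^{(i)}-B^{(i)}x_i)_j : \tau_{ij}\in\mathbb{R}[x]\Big\},$$ and, for integers $t\ge l$, $$\mathrm{QM}_t=\Big\{\sigma_0+\sum_{i=1}^l\sum_{j=1}^{m_i}\sigma_{ij}(a^{(i)}-A^{(i)}x_i)_j : \sigma_0\in\Sigma_{2t}[x],\ \sigma_{ij}\in\Sigma_{2t-2}[x]\Big\},\quad \mathrm{I}_t=\Big\{\sum_{i=1}^l\sum_{j=1}^{n_i}\tau_{ij}(b^{(i)}-B^{(i)}x_i)_j : \tau_{ij}\in\mathbb{R}_{2t-1}[x]\Big\}.$$ The infimum of the empty set is $+\infty$. *)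

(* Defs.v *)
From mathcomp Require Import all_boot all_order all_algebra.
From mathcomp Require Import -(notations) mpoly.
From mathcomp Require Import all_classical all_reals all_analysis.
Set Implicit Arguments.
Unset Strict Implicit.
Unset Printing Implicit Defensive.
Import Order.TTheory GRing.Theory Num.Theory.
Import numFieldNormedType.Exports.
Local Open Scope classical_set_scope.
Local Open Scope ring_scope.

(* mpoly is imported without its notations, which clash with those of
   MathComp-Analysis. *)
Notation "{ 'mpoly' T [ n ] }" := (mpoly.mpoly n T)
  (at level 0, T, n at level 2, format "{ 'mpoly'  T [ n ] }") : type_scope.

(* The ring R[x] in all the variables x_{i,j}, i < l, j < d i; the pair (i, j)
   is turned into a single index by the bijection tagnat.Rank. Blocks and
   coordinates are numbered from 0. *)
Notation blockpoly R d := {mpoly R[(\sum_i d i)%N]}.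

Definition bvar (R : realType) (l : nat) (d : 'I_l -> nat) (i : 'I_l)
    (j : 'I_(d i)) : blockpoly R d :=
  mpoly.mpolyX R (mpoly.mnm1 (tagnat.Rank i j)).

Definition cstpoly (R : realType) (l : nat) (d : 'I_l -> nat) (c : R) :
  blockpoly R d := mpoly.mpolyC _ c.

Definition bpoint (R : realType) (l : nat) (d : 'I_l -> nat) :=
  forall i : 'I_l, 'cV[R]_(d i).

Definition beval (R : realType) (l : nat) (d : 'I_l -> nat)
    (x : bpoint R d) (p : blockpoly R d) : R :=
  mpoly.meval (fun k => x (tagnat.sig1 k) (tagnat.sig2 k) ord0) p.

(* deg p <= k, where msize p is 1 + deg p, and 0 if p = 0 *)
Definition degle (R : realType) (l : nat) (d : 'I_l -> nat) (k : nat)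
    (p : blockpoly R d) : Prop :=
  (mpoly.msize p <= k.+1)%N.

Definition tensor_index (l : nat) (d : 'I_l -> nat) (L : {set 'I_l}) : finType :=
  {dffun forall i : {i : 'I_l | i \in L}, 'I_(d (val i))}.

Definition tensor_form (R : realType) (l : nat) (d : 'I_l -> nat)
    (L : {set 'I_l}) (Q : tensor_index d L -> R) : blockpoly R d :=
  \sum_(al : tensor_index d L)
    cstpoly d (Q al) * \prod_(i : {i : 'I_l | i \in L}) bvar R (al i).

Definition multilinear (R : realType) (l : nat) (d : 'I_l -> nat)
    (f : blockpoly R d) : Prop :=
  exists Q : forall L : {set 'I_l}, tensor_index d L -> R,
    f = \sum_(L : {set 'I_l} | L != finset.set0) tensor_form (Q L) /\
    (exists al : tensor_index d finset.setT, Q finset.setT al != 0).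

Definition eqspace (R : realType) (d n : nat) (b : 'cV[R]_n) (B : 'M[R]_(n, d)) :
  set 'cV[R]_d := [set x | b = B *m x].

Definition polyhedron (R : realType) (d m n : nat) (a : 'cV[R]_m)
    (A : 'M[R]_(m, d)) (b : 'cV[R]_n) (B : 'M[R]_(n, d)) : set 'cV[R]_d :=
  [set x | eqspace b B x /\ forall j, (A *m x) j ord0 <= a j ord0].

(* interior of S with respect to the topology induced on X *)
Definition relint (R : realType) (d : nat) (X S : set 'cV[R]_d) :
  set 'cV[R]_d := [set x | S x /\ X x /\ within X (nbhs x) S].

Definition aff_hull (R : realType) (d : nat) (S : set 'cV[R]_d) :
    set 'cV[R]_d :=
  [set y | exists (k : nat) (p : 'I_k -> 'cV[R]_d) (c : 'I_k -> R),
    [/\ forall i, S (p i), \sum_i c i = 1 & y = \sum_i c i *: p i]].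

(* S is nonempty and its affine hull has dimension k *)
Definition has_affdim (R : realType) (d : nat) (S : set 'cV[R]_d) (k : nat) :
    Prop :=
  exists (x0 : 'cV[R]_d) (U : {vspace 'cV[R]_d}),
    aff_hull S = [set x0 + u | u in [set` U]] /\ (\dim U)%VS = k.

Definition assumptionA (R : realType) (l : nat) (d m n : 'I_l -> nat)
    (a : forall i, 'cV[R]_(m i)) (A : forall i, 'M[R]_(m i, d i))
    (b : forall i, 'cV[R]_(n i)) (B : forall i, 'M[R]_(n i, d i)) : Prop :=
  forall i,
    [/\ (n i < d i)%N,
        has_affdim (eqspace (b i) (B i)) (d i - n i)
      & has_affdim (polyhedron (a i) (A i) (b i) (B i)) (d i - n i)].

Definition feasible (R : realType) (l : nat) (d m n : 'I_l -> nat)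
    (a : forall i, 'cV[R]_(m i)) (A : forall i, 'M[R]_(m i, d i))
    (b : forall i, 'cV[R]_(n i)) (B : forall i, 'M[R]_(n i, d i)) :
    set (bpoint R d) :=
  [set x | forall i, polyhedron (a i) (A i) (b i) (B i) (x i)].

Definition ismax (T : Type) (R : realType) (D : set T) (g : T -> R) (v : R) :
    Prop :=
  (exists2 x, D x & g x = v) /\ (forall x, D x -> g x <= v).

Definition sos (R : realType) (l : nat) (d : 'I_l -> nat) : set (blockpoly R d) :=
  [set p | exists s : seq (blockpoly R d), p = \sum_(q <- s) q ^+ 2].

Definition sos_le (R : realType) (l : nat) (d : 'I_l -> nat) (k : nat) :
    set (blockpoly R d) := @sos R l d `&` [set p | degle k p].

(* the polynomial (c - M x_i)_j *)
Definition residual (R : realType) (l : nat) (d : 'I_l -> nat) (i : 'I_l)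
    (k : nat) (c : 'cV[R]_k) (M : 'M[R]_(k, d i)) (j : 'I_k) : blockpoly R d :=
  cstpoly d (c j ord0) - \sum_(s < d i) cstpoly d (M j s) * bvar R s.

Definition QM_gen (R : realType) (l : nat) (d m : 'I_l -> nat)
    (S0 S1 : set (blockpoly R d))
    (a : forall i, 'cV[R]_(m i)) (A : forall i, 'M[R]_(m i, d i)) :
    set (blockpoly R d) :=
  [set p | exists (s0 : blockpoly R d) (s : forall i, 'I_(m i) -> blockpoly R d),
    [/\ S0 s0, forall i j, S1 (s i j)
      & p = s0 + \sum_i \sum_(j < m i) s i j * residual (a i) (A i) j]].

Definition QM (R : realType) (l : nat) (d m : 'I_l -> nat)
    (a : forall i, 'cV[R]_(m i)) (A : forall i, 'M[R]_(m i, d i)) :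
    set (blockpoly R d) :=
  QM_gen (@sos R l d) (@sos R l d) a A.

Definition QMt (R : realType) (l : nat) (d m : 'I_l -> nat) (t : nat)
    (a : forall i, 'cV[R]_(m i)) (A : forall i, 'M[R]_(m i, d i)) :
    set (blockpoly R d) :=
  QM_gen (@sos_le R l d (2 * t)) (@sos_le R l d (2 * t - 2)) a A.

Definition I_gen (R : realType) (l : nat) (d n : 'I_l -> nat)
    (S : set (blockpoly R d))
    (b : forall i, 'cV[R]_(n i)) (B : forall i, 'M[R]_(n i, d i)) :
    set (blockpoly R d) :=
  [set p | exists tau : forall i, 'I_(n i) -> blockpoly R d,
    (forall i j, S (tau i j)) /\
    p = \sum_i \sum_(j < n i) tau i j * residual (b i) (B i) j].

Definition Iid (R : realType) (l : nat) (d n : 'I_l -> nat)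
    (b : forall i, 'cV[R]_(n i)) (B : forall i, 'M[R]_(n i, d i)) :
    set (blockpoly R d) :=
  I_gen setT b B.

Definition Iidt (R : realType) (l : nat) (d n : 'I_l -> nat) (t : nat)
    (b : forall i, 'cV[R]_(n i)) (B : forall i, 'M[R]_(n i, d i)) :
    set (blockpoly R d) :=
  I_gen [set p | degle (2 * t - 1) p] b B.

Definition sumset (V : zmodType) (X Y : set V) : set V :=
  [set x + y | x in X & y in Y].

(* ereal_inf set0 = +oo *)
Definition ft (R : realType) (l : nat) (d m n : 'I_l -> nat)
    (a : forall i, 'cV[R]_(m i)) (A : forall i, 'M[R]_(m i, d i))
    (b : forall i, 'cV[R]_(n i)) (B : forall i, 'M[R]_(n i, d i))
    (f : blockpoly R d) (t : nat) : \bar R :=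
  ereal_inf [set mu%:E | mu in
    [set mu : R | sumset (QMt t a A) (Iidt t b B) (cstpoly d mu - f)]].

(* Main.v *)
(* The set M = QM + I is a quadratic module containing the affine polynomials
   g_j that cut out the polytope K (an equality counts as two inequalities).

   Putinar's theorem for K (positive on K implies in M) goes as follows. By Farkas'
   lemma M contains N ± x_s, hence b = N^2 - |x|^2, hence the preordering T
   generated by b. If f > 0 on K, then f - λ Σ (1 - g_j)^{2k} g_j > 0 on the cube
   [-N, N]^n for suitable λ and k; and a polynomial positive on the cube lies in T,
   because it dominates c - C |x - p|^2 modulo T for all points p of the cube, and
   averaging this over the end points p of a random walk of mean x, with weights
   in T, makes the quadratic term small. This gives part (1).

   Let F = f^* - f have finitely many zeros on K. Multilinearity makes the
   derivative of F at a zero z positive along K, so by Farkas it is Σ c_j g_j with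
   c_j > 0 for enough active constraints to generate the coordinates h = x - z.
   Completing squares, F = m + |h|^2 + Σ h_s h_t o_st with m in M and o_st(z) = 0.
   These expressions are glued over the zeros into F = m + Σ V_i^2 d +
   Σ V_i V_j o_ij, with d > 0 and o_ij = 0 at all of them. With the peak
   A = (1 - ΣV_i^2 / N)^k, the polynomial F - A^2 m is then a combination of the
   squares (V_i ± V_j)^2 with coefficients that are positive on K for large k, so
   it lies in M by Putinar's theorem. *)
Require Import Defs.
From mathcomp Require Import all_boot all_order all_algebra.
From mathcomp Require Import -(notations) mpoly.
From mathcomp Require Import all_classical all_reals all_analysis.
From mathcomp Require Import zify ring lra.
Set Implicit Arguments.
Unset Strict Implicit.
Unset Printing Implicit Defensive.
Import Order.TTheory GRing.Theory Num.Theory.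
Import numFieldNormedType.Exports.
Local Open Scope classical_set_scope.
Local Open Scope ring_scope.

(** * Farkas' lemma *)

Section Farkas.
Variables (R : realType) (W : lmodType R).

Definition functional (f : W -> R) :=
  forall c x y, f (c *: x + y) = c * f x + f y.

Lemma functional0 (f : W -> R) : functional f -> f 0 = 0.
Proof.
move=> fl; have := fl (-1) 0 0; rewrite scaler0 addr0 mulN1r => h.
by rewrite h addNr.
Qed.

(* Bartl's induction: a point violating the claim for all constraints but the
   first is used to project the others onto the kernel of the first. *)
Lemma farkas_ord m (a : 'I_m -> W -> R) (b : W -> R) :
  (forall j, functional (a j)) -> functional b ->
  (forall x, (forall j, 0 <= a j x) -> 0 <= b x) ->
  exists2 c : 'I_m -> R, (forall j, 0 <= c j) &
    forall x, b x = \sum_j c j * a j x.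
Proof.
elim: m a b => [|m IH] a b al bl ab.
  exists (fun=> 0) => // x; rewrite big_ord0; apply/eqP; rewrite eq_le.
  have h y : 0 <= b y by apply: ab => -[].
  rewrite h andbT -oppr_ge0; apply: le_trans (h (- x)) _.
  by have := bl (-1) x 0; rewrite functional0 // !addr0 scaleN1r mulN1r => ->.
have [h|/existsNP[x' /not_implyP[ax' /negP]]] :=
    pselect (forall x, (forall j, 0 <= a (lift ord0 j) x) -> 0 <= b x).
  have [c c0 cE] := IH _ _ (fun j => al (lift ord0 j)) bl h.
  exists (fun j => if unlift ord0 j is Some i then c i else 0).
    by move=> j; case: unliftP.
  move=> x; rewrite big_ord_recl /= unlift_none mul0r add0r cE.
  by apply: eq_bigr => j _; rewrite /= liftK.
rewrite -ltNge => bx'.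
(* [x'] meets every constraint but the first and has [b x' < 0], so the hypothesis forces
   [a ord0 x' < 0]. *)
pose t := - a ord0 x'.
have t0 : 0 < t.
  rewrite oppr_gt0 ltNge; apply/negP => a0x'.
  have /ab : forall j, 0 <= a j x'.
    by move=> j; case: (unliftP ord0 j) => [i|] ->.
  by rewrite leNgt bx'.
have tn0 : t != 0 by rewrite gt_eqF.
(* Values of the functionals at x + (a_0(x) / t) x', the projection of x along [x'] onto the kernel
   of a_0. *)
pose a' j x := a (lift ord0 j) x + a (lift ord0 j) x' / t * a ord0 x.
pose b' x := b x + b x' / t * a ord0 x.
have [||x a'x|c c0 cE] := IH a' b'.
- by move=> j e x y; rewrite /a' !al; ring.
- by move=> e x y; rewrite /b' bl al; ring.
- have /ab : forall j, 0 <= a j ((a ord0 x / t) *: x' + x).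
    move=> j; rewrite al; case: (unliftP ord0 j) => [i|] ->.
      by apply: le_trans (a'x i) _; rewrite /a' le_eqVlt; apply/orP/or_introl/eqP; field.
    by rewrite -[a ord0 x' in X in _ <= X]opprK -/t mulrN divfK // addNr.
  by move=> /le_trans; apply; rewrite bl /b' le_eqVlt; apply/orP/or_introl/eqP; field.
(* Undoing the projection gives the first coefficient, which is nonnegative because b is negative at
   [x'] and the other constraints are not. *)
exists (fun j => if unlift ord0 j is Some i then c i
  else (\sum_i c i * a (lift ord0 i) x' - b x') / t).
  move=> j; case: unliftP => // _; apply: divr_ge0 (ltW t0).
  rewrite subr_ge0; apply: le_trans (ltW bx') _.
  by apply: sumr_ge0 => i _; rewrite mulr_ge0.
move=> x; rewrite big_ord_recl /= unlift_none.
under [X in _ = _ + X]eq_bigr do rewrite /= liftK.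
have -> : b x = b' x - b x' / t * a ord0 x by rewrite /b' addrK.
rewrite cE.
have -> : \sum_(i < m) c i * a' i x = \sum_(i < m) c i * a (lift ord0 i) x +
   (\sum_(i < m) c i * a (lift ord0 i) x') / t * a ord0 x.
  rewrite !mulr_suml -big_split /=; apply: eq_bigr => i _; rewrite /a'; ring.
ring.
Qed.

Lemma farkas (J : finType) (a : J -> W -> R) (b : W -> R) :
  (forall j, functional (a j)) -> functional b ->
  (forall x, (forall j, 0 <= a j x) -> 0 <= b x) ->
  exists2 c : J -> R, (forall j, 0 <= c j) & forall x, b x = \sum_j c j * a j x.
Proof.
move=> al bl ab.
have [|//|x ax|c c0 cE] := @farkas_ord #|J| (fun i => a (enum_val i)) b.
- by move=> j; exact: al.
- by apply: ab => j; have := ax (enum_rank j); rewrite enum_rankK.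
exists (c \o enum_rank) => [j|x]; first exact: c0.
rewrite cE (reindex _ (onW_bij _ (@enum_rank_bij J))) /=.
by apply: eq_bigr => j _; rewrite enum_rankK.
Qed.

End Farkas.

(** * Evaluation at points and the affine form of Farkas' lemma *)

Section Affine.
Variables (R : realType) (n : nat).
Local Notation P := {mpoly R[n]}.
Local Notation C := (@mpolyC n R).
Local Notation X := (fun s : 'I_n => @mpolyX n R (mnm1 s)).

Definition ev (x : 'rV[R]_n) (p : P) : R := meval (x ord0) p.

Lemma evD x p q : ev x (p + q) = ev x p + ev x q. Proof. exact: mevalD. Qed.
Lemma evB x p q : ev x (p - q) = ev x p - ev x q. Proof. exact: mevalB. Qed.
Lemma evN x p : ev x (- p) = - ev x p. Proof. exact: mevalN. Qed.
Lemma evM x p q : ev x (p * q) = ev x p * ev x q. Proof. exact: mevalM. Qed.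
Lemma evXn x p k : ev x (p ^+ k) = ev x p ^+ k.
Proof. by rewrite /ev rmorphXn. Qed.
Lemma evC x c : ev x (C c) = c. Proof. exact: mevalC. Qed.
Lemma ev0 x : ev x 0 = 0. Proof. exact: meval0. Qed.
Lemma ev1 x : ev x 1 = 1. Proof. exact: meval1. Qed.
Lemma evX x s : ev x (X s) = x ord0 s. Proof. exact: mevalXU. Qed.
Lemma ev_sum x (I : Type) (r : seq I) (Q : pred I) (f : I -> P) :
  ev x (\sum_(i <- r | Q i) f i) = \sum_(i <- r | Q i) ev x (f i).
Proof. by rewrite /ev rmorph_sum. Qed.

Definition evE := (evD, evB, evN, evM, evXn, evC, ev0, ev1, evX, ev_sum).

Definition dot (u v : 'rV[R]_n) : R := \sum_s u ord0 s * v ord0 s.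

Lemma functional_dot u : functional (dot u).
Proof.
move=> c x y; rewrite /dot mulr_sumr -big_split /=; apply: eq_bigr => s _.
by rewrite !mxE; ring.
Qed.

Definition lin (u : 'rV[R]_n) : P := \sum_s C (u ord0 s) * X s.

Lemma ev_lin x u : ev x (lin u) = dot u x.
Proof. by rewrite /lin !evE; apply: eq_bigr => s _; rewrite !evE. Qed.

Definition aff (al : R) (u : 'rV[R]_n) : P := C al + lin u.

Lemma ev_aff x al u : ev x (aff al u) = al + dot u x.
Proof. by rewrite evD evC ev_lin. Qed.

Lemma lin_sum (J : finType) (c : J -> R) (u : J -> 'rV[R]_n) :
  lin (\sum_j c j *: u j) = \sum_j C (c j) * lin (u j).
Proof.
rewrite /lin.
under [RHS]eq_bigr do rewrite mulr_sumr.
rewrite exchange_big /=; apply: eq_bigr => s _.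
rewrite summxE rmorph_sum mulr_suml; apply: eq_bigr => j _ /=.
by rewrite mxE mpolyCM mulrA.
Qed.

Lemma lin_scale c u : lin (c *: u) = C c * lin u.
Proof.
by rewrite /lin mulr_sumr; apply: eq_bigr => s _; rewrite mxE mpolyCM mulrA.
Qed.

Lemma lin_delta s : lin (delta_mx ord0 s) = X s.
Proof.
rewrite /lin (bigD1 s) //= big1 => [|t /negPf ts]; rewrite mxE ?eqxx /=.
  by rewrite mpolyC1 mul1r addr0.
by rewrite ts mpolyC0 mul0r.
Qed.

Lemma dot_delta u s : dot u (delta_mx ord0 s) = u ord0 s.
Proof.
rewrite /dot (bigD1 s) //= big1 => [|i /negPf is_]; rewrite mxE ?eqxx /=.
  by rewrite mulr1 addr0.
by rewrite is_ mulr0.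
Qed.

Lemma dot_inj u v : (forall x, dot u x = dot v x) -> u = v.
Proof. by move=> h; apply/rowP => s; rewrite -!dot_delta h. Qed.

Lemma dot_suml (J : finType) (c : J -> R) (u : J -> 'rV[R]_n) x :
  dot (\sum_j c j *: u j) x = \sum_j c j * dot (u j) x.
Proof. by rewrite -ev_lin lin_sum ev_sum; apply: eq_bigr => j _;
  rewrite evM evC ev_lin. Qed.

Lemma farkas_lin (J : finType) (u : J -> 'rV[R]_n) (v : 'rV[R]_n) :
  (forall x, (forall j, 0 <= dot (u j) x) -> 0 <= dot v x) ->
  exists2 c : J -> R, (forall j, 0 <= c j) & v = \sum_j c j *: u j.
Proof.
move=> h.
have [c c0 cE] := farkas (fun j => functional_dot (u j)) (functional_dot v) h.
by exists c => //; apply: dot_inj => x; rewrite cE dot_suml.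
Qed.

(** Homogenization: the linear lemma is applied on R x R^n to the forms al_j t + u_j x together with
    t >= 0. For t > 0 the hypothesis is rescaled; for t = 0 the vector x is a recession direction,
    and starting from [x0] rules out v x < 0. *)
Lemma farkas_aff (J : finType) (al : J -> R) (u : J -> 'rV[R]_n) (be : R)
    (v : 'rV[R]_n) (x0 : 'rV[R]_n) :
  (forall j, 0 <= ev x0 (aff (al j) (u j))) ->
  (forall x, (forall j, 0 <= ev x (aff (al j) (u j))) -> 0 <= ev x (aff be v)) ->
  exists c0 (c : J -> R), [/\ 0 <= c0, forall j, 0 <= c j &
    aff be v = C c0 + \sum_j C (c j) * aff (al j) (u j)].
Proof.
move=> x0K h.
pose W : lmodType R := (R^o * 'rV[R]_n)%type.
pose a (o : option J) (w : W) : R :=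
  if o is Some j then al j * w.1 + dot (u j) w.2 else w.1.
pose b (w : W) : R := be * w.1 + dot v w.2.
have [k|e x y|w aw|c c0 cE] := @farkas R W _ a b.
- case: k => [j|] e x y /=; last by [].
  by rewrite functional_dot; set z := _ *: _; have -> : z = e * x.1 by []; ring.
- by rewrite /b /= functional_dot; set z := _ *: _; have -> : z = e * x.1 by []; ring.
- case: w aw => t x aw; rewrite /b /=.
  have /= t0 := aw None.
  have {aw} aw j : 0 <= al j * t + dot (u j) x by exact: (aw (Some j)).
  have [tp|] := ltrP 0 t.
    have h' : 0 <= ev (t^-1 *: x) (aff be v).
      apply: h => j; rewrite ev_aff.
      have := functional_dot (u j) t^-1 x 0; rewrite addr0 functional0;
        last exact: functional_dot.
      rewrite addr0 => ->; rewrite -(pmulr_rge0 _ tp).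
      apply: le_trans (aw j) _; rewrite le_eqVlt; apply/orP/or_introl/eqP.
      by field; rewrite gt_eqF.
    have := functional_dot v t^-1 x 0; rewrite addr0 functional0;
      last exact: functional_dot.
    rewrite addr0 => E; move: h'; rewrite ev_aff E -(pmulr_rge0 _ tp).
    move=> /le_trans; apply; rewrite le_eqVlt; apply/orP/or_introl/eqP.
    by field; rewrite gt_eqF.
  move=> tn; have {tn t0} t0 : t = 0 by apply/eqP; rewrite eq_le tn.
  rewrite t0 mulr0 add0r leNgt; apply/negP => vx.
  have ge0 e : 0 <= e -> 0 <= be + e * dot v x + dot v x0.
    move=> e0; have := h (e *: x + x0); rewrite ev_aff functional_dot addrA; apply => j.
    rewrite ev_aff functional_dot.
    have := aw j; rewrite t0 mulr0 add0r => ujx.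
    have := x0K j; rewrite ev_aff => ?.
    by have := mulr_ge0 e0 ujx; lra.
  (* This far along the ray from [x0] the affine function would be at most -1. *)
  have := ge0 ((1 + `|be + dot v x0|) / - dot v x).
  have -> : (1 + `|be + dot v x0|) / - dot v x * dot v x = - (1 + `|be + dot v x0|).
    by field; rewrite lt_eqF.
  have e0 : 0 <= (1 + `|be + dot v x0|) / - dot v x.
    by rewrite divr_ge0 // ?addr_ge0 // oppr_ge0 ltW.
  by move=> /(_ e0); have := ler_norm (be + dot v x0); lra.
exists (c None), (c \o some); split => //=.
have sumE (f : option J -> R) : \sum_o f o = f None + \sum_j f (Some j).
  rewrite (bigD1 None) //=; congr (_ + _).
  rewrite (reindex_omap Some (fun o : option J => o)) /=; last by case.
  by apply: eq_bigl => j; rewrite eqxx.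
have bE : be = c None + \sum_j c (Some j) * al j.
  have := cE (1, 0); rewrite /b /a /= sumE /= functional0; last exact: functional_dot.
  rewrite !mulr1 addr0 => ->; congr (_ + _); apply: eq_bigr => j _.
  by rewrite functional0 ?addr0 ?mulr1 //; exact: functional_dot.
have vE : v = \sum_j c (Some j) *: u j.
  apply: dot_inj => x; have := cE (0, x); rewrite /b /a /= sumE /= mulr0 add0r => ->.
  rewrite mulr0 add0r dot_suml; apply: eq_bigr => j _.
  by rewrite mulr0 add0r.
rewrite /aff {1}bE {1}vE lin_sum mpolyCD rmorph_sum -addrA -big_split /=.
by congr (_ + _); apply: eq_bigr => j _; rewrite mpolyCM; ring.
Qed.

End Affine.

(** * Polynomials positive on a cube *)

Section Preordering.
Variables (R : realType) (n : nat).
Local Notation P := {mpoly R[n]}.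
Local Notation C := (@mpolyC n R).
Local Notation X := (fun s : 'I_n => @mpolyX n R (mnm1 s)).

(** Polynomials are generated as an algebra by constants and variables; bounds, Lipschitz
    certificates, continuity and Hadamard expansions are all propagated through sums and products in
    this way. *)
Lemma mpoly_alg_ind (Q : P -> Prop) :
  (forall c, Q (C c)) -> (forall s, Q (X s)) ->
  (forall p q, Q p -> Q q -> Q (p + q)) ->
  (forall p q, Q p -> Q q -> Q (p * q)) -> forall p, Q p.
Proof.
move=> QC QX QD hM; elim/mpolyind => [|c m p _ _ Qp].
  by rewrite -(mpolyC0 n R).
apply: QD Qp; rewrite -mul_mpolyC; apply: (hM) => //.
rewrite mpolyXE_id; elim/big_ind: _ => [|p1 p2 h1 h2|s _].
- by rewrite -(mpolyC1 n R).
- exact: hM.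
elim: (m s) => [|k IH]; first by rewrite expr0 -(mpolyC1 n R).
by rewrite exprS; apply: hM.
Qed.

Definition cube (N : R) (x : 'rV[R]_n) := forall s, `|x ord0 s| <= N.

Lemma cube_bounded N (f : P) : exists2 B, 0 <= B &
  forall x, cube N x -> `|ev x f| <= B.
Proof.
elim/mpoly_alg_ind: f => [c|s|p q [B B0 hB] [D D0 hD]|p q [B B0 hB] [D D0 hD]].
- by exists `|c| => // x _; rewrite evC.
- by exists `|N| => // x hx; rewrite evX (le_trans (hx s)) ?ler_norm.
- exists (B + D) => [|x hx]; first exact: addr_ge0.
  by rewrite evD (le_trans (ler_normD _ _)) // lerD ?hB ?hD.
- exists (B * D) => [|x hx]; first exact: mulr_ge0.
  by rewrite evM normrM ler_pM ?hB ?hD.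
Qed.

Variables (T : P -> Prop) (N : R).
Hypothesis N0 : 0 < N.
Hypothesis TD : forall p q, T p -> T q -> T (p + q).
Hypothesis TM : forall p q, T p -> T q -> T (p * q).
Hypothesis Tsqr : forall p, T (p ^+ 2).
Hypothesis Tp : forall s, T (C N + X s).
Hypothesis Tm : forall s, T (C N - X s).

Lemma preorderC c : 0 <= c -> T (C c).
Proof. by move=> c0; rewrite -(sqr_sqrtr c0) rmorphXn. Qed.

Lemma preorder_sum (I : Type) (r : seq I) (Q : pred I) (f : I -> P) :
  (forall i, Q i -> T (f i)) -> T (\sum_(i <- r | Q i) f i).
Proof.
move=> h; elim/big_ind: _ => //; exact: (preorderC (lexx 0)).
Qed.

Lemma preorder_box s : T (C (N ^+ 2) - X s ^+ 2).
Proof. by rewrite rmorphXn subr_sqr; apply: TM. Qed.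

(** Archimedean property of T, propagated through sums by the parallelogram law. *)
Lemma preorder_arch f : exists2 c, 0 <= c & T (C c - f ^+ 2).
Proof.
elim/mpoly_alg_ind: f => [c|s|p q [B B0 hB] [D D0 hD]|p q [B B0 hB] [D D0 hD]].
- exists (c ^+ 2); first exact: sqr_ge0.
  by rewrite -rmorphXn subrr; exact: (preorderC (lexx 0)).
- by exists (N ^+ 2); [exact: sqr_ge0|exact: preorder_box].
- exists (2 * (B + D)); first by rewrite mulr_ge0 ?addr_ge0.
  have -> : C (2 * (B + D)) - (p + q) ^+ 2 =
    C 2 * (C B - p ^+ 2) + C 2 * (C D - q ^+ 2) + (p - q) ^+ 2 by ring.
  by do !apply: TD => //; apply: TM => //; exact: preorderC.
- exists (B * D); first exact: mulr_ge0.
  have -> : C (B * D) - (p * q) ^+ 2 =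
    C B * (C D - q ^+ 2) + q ^+ 2 * (C B - p ^+ 2) by ring.
  by apply: TD; apply: TM => //; exact: preorderC.
Qed.

Definition sqdist (x : 'rV[R]_n) : P := \sum_s (X s - C (x ord0 s)) ^+ 2.

(** A Lipschitz estimate certified in T, uniform in the point x. For products, pq - uv is split as
    (p - u) q + u (q - v), where q is bounded as a polynomial by [preorder_arch] and u as a number
    on the cube. *)
Lemma preorder_lipschitz f : exists2 c, 0 <= c & forall x, cube N x ->
  T (C c * sqdist x - (f - C (ev x f)) ^+ 2).
Proof.
elim/mpoly_alg_ind: f => [c|s|p q [B B0 hB] [D D0 hD]|p q [B B0 hB] [D D0 hD]].
- exists 0 => // x _; rewrite evC subrr expr0n subr0 mul0r.
  exact: (preorderC (lexx 0)).
- exists 1 => // x _; rewrite evX mul1r /sqdist (bigD1 s) //= addrC addrK.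
  exact: preorder_sum.
- exists (2 * (B + D)) => [|x hx]; first by rewrite mulr_ge0 ?addr_ge0.
  rewrite evD mpolyCD; set u := C (ev x p); set v := C (ev x q).
  have -> : C (2 * (B + D)) * sqdist x - (p + q - (u + v)) ^+ 2 =
    C 2 * (C B * sqdist x - (p - u) ^+ 2) + C 2 * (C D * sqdist x - (q - v) ^+ 2)
    + (p - u - (q - v)) ^+ 2 by ring.
  apply: TD (Tsqr _); apply: TD; apply: TM;
    [exact: preorderC|exact: hB|exact: preorderC|exact: hD].
- have [E E0 hE] := preorder_arch q.
  have [G G0 hG] := cube_bounded N p.
  exists (2 * E * B + 2 * G ^+ 2 * D) => [|x hx].
    by rewrite addr_ge0 ?mulr_ge0 ?sqr_ge0.
  rewrite evM mpolyCM; set u := C (ev x p); set v := C (ev x q).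
  have -> : C (2 * E * B + 2 * G ^+ 2 * D) * sqdist x - (p * q - (u * v)) ^+ 2 =
    C (2 * E) * (C B * sqdist x - (p - u) ^+ 2)
    + C (2 * G ^+ 2) * (C D * sqdist x - (q - v) ^+ 2)
    + C 2 * (p - u) ^+ 2 * (C E - q ^+ 2)
    + C (2 * (G ^+ 2 - ev x p ^+ 2)) * (q - v) ^+ 2
    + ((p - u) * q - u * (q - v)) ^+ 2 by rewrite /u /v; ring.
  apply: TD (Tsqr _); do 3 ?apply: TD; do ?apply: TM => //;
    try exact: preorderC; try exact: hB; try exact: hD.
  + by apply: preorderC; rewrite mulr_ge0.
  + by apply: preorderC; rewrite mulr_ge0 ?sqr_ge0.
  + apply: preorderC; rewrite mulr_ge0 // subr_ge0 -real_normK ?num_real //.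
    by rewrite ler_sqr ?nnegrE // hG.
Qed.

(* A random walk with steps ±N e_s of mean X_s, its weights (N ± X_s) / 2N lying
   in T: after k steps in each direction, of which j have been made and led to
   q, the expected square distance of the end point to (k X_s)_s is the bracket
   below. *)
Lemma preorder_walk (f : P) (c c' : R) (k : nat) : (0 < k)%N -> 0 <= c ->
  (forall x, cube N x -> T (f - C c' + C c * sqdist x)) ->
  forall m (j : 'I_n -> nat) (q : 'I_n -> R), (forall s, (j s <= k)%N) ->
  (\sum_s (k - j s) = m)%N -> (forall s, `|q s| <= (j s)%:R * N) ->
  T (f - C c' + C (c / k%:R ^+ 2) *
       \sum_s ((C (q s) - C (j s)%:R * X s) ^+ 2
              + C (k - j s)%:R * (C (N ^+ 2) - X s ^+ 2))).
Proof.
move=> k0 c0 Tf; have kn0 : k%:R != 0 :> R by rewrite pnatr_eq0 -lt0n.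
elim=> [|m IH] j q jk jm qj.
  have jE s : j s = k.
    have /eqP := jm; rewrite sum_nat_eq0 => /forallP/(_ s)/=.
    by rewrite subn_eq0 => kj; apply/eqP; rewrite eqn_leq jk.
  (* No step is left: the variance term is gone, and the end point q / k lies in the cube. *)
  have := Tf (\row_s (q s / k%:R)).
  have -> : C c * sqdist (\row_s (q s / k%:R)) = C (c / k%:R ^+ 2) *
      \sum_s ((C (q s) - C (j s)%:R * X s) ^+ 2
              + C (k - j s)%:R * (C (N ^+ 2) - X s ^+ 2)).
    rewrite /sqdist !mulr_sumr; apply: eq_bigr => s _.
    rewrite jE subnn mpolyC0 mul0r addr0 mxE.
    have -> : C c = C (c / k%:R ^+ 2) * C k%:R ^+ 2.
      by rewrite [C _ ^+ 2]expr2 -!mpolyCM -expr2 divfK // expf_neq0.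
    have -> : C (q s) = C k%:R * C (q s / k%:R) by rewrite -mpolyCM mulrC divfK.
    ring.
  apply=> s; rewrite mxE normrM normfV (ger0_norm (ler0n _ _)).
  by rewrite ler_pdivrMr ?ltr0n // mulrC (le_trans (qj s)) // jE.
have [s js] : exists s, (j s < k)%N.
  apply/not_existsP => h; suff : (\sum_s (k - j s) = 0)%N by rewrite jm.
  rewrite big1 // => s _; apply/eqP; rewrite subn_eq0 leqNgt; exact/negP/h.
pose j' t := if t == s then (j t).+1 else j t.
pose q' (e : R) t := if t == s then q t + e else q t.
have step e : `|e| = N -> T (f - C c' + C (c / k%:R ^+ 2) *
     \sum_t ((C (q' e t) - C (j' t)%:R * X t) ^+ 2
            + C (k - j' t)%:R * (C (N ^+ 2) - X t ^+ 2))).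
  move=> eN; apply: IH => [t||t].
  - by rewrite /j'; case: eqP => // ->.
  - rewrite (bigD1 s) //=; move: jm; rewrite (bigD1 s) //= {1}/j' eqxx.
    under [X in (_ + X = m)%N]eq_bigr => t /negPf ts do rewrite /j' ts.
    have -> : (k - j s = (k - (j s).+1).+1)%N by rewrite -subSn // subSS.
    by rewrite addSn => -[].
  - rewrite /q' /j'; case: eqP => // _.
    by rewrite (le_trans (ler_normD _ _)) // eN -[(j t).+1]addn1 natrD mulrDl mul1r lerD.
have nN : `|- N| = N by rewrite normrN gtr0_norm.
have pN : `|N| = N by rewrite gtr0_norm.
(* [w] is the probability of the step +N; the mean step N (2w - 1) is then [X s]. *)
pose w := C (2 * N)^-1 * (C N + X s).
have wT : T w by apply: TM => //; apply: preorderC; rewrite invr_ge0 mulr_ge0 // ltW.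
have w1 : 1 - w = C (2 * N)^-1 * (C N - X s).
  have : C (2 * N)^-1 * C (2 * N) = 1 by rewrite -mpolyCM mulVf // mulf_neq0 // gt_eqF.
  by rewrite /w => <-; ring.
have w1T : T (1 - w).
  by rewrite w1; apply: TM => //; apply: preorderC; rewrite invr_ge0 mulr_ge0 // ltW.
have XE : X s = C N * (2 * w - 1).
  have h : C (2 * N)^-1 * C N * 2 = 1.
    by rewrite -(mpolyC_nat n R 2) -!mpolyCM -mulrA [N * 2]mulrC mulVf ?mpolyC1 // mulf_neq0 ?gt_eqF.
  by rewrite /w; transitivity ((C (2 * N)^-1 * C N * 2) * (C N + X s) - C N);
    [rewrite h|]; ring.
(* The bracket for [j] is the average, with weights w and 1 - w, of the brackets after the next
   step. *)
have := TD (TM wT (step N pN)) (TM w1T (step (- N) nN)).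
have splitE (F : 'I_n -> P) : \sum_t F t = F s + \sum_(t < n | t != s) F t by rewrite (bigD1 s).
have qE e : q' e s = q s + e by rewrite /q' eqxx.
have jE : j' s = (j s).+1 by rewrite /j' eqxx.
rewrite !splitE !qE !jE.
have restE e : \sum_(t < n | t != s) ((C (q' e t) - C (j' t)%:R * X t) ^+ 2
            + C (k - j' t)%:R * (C (N ^+ 2) - X t ^+ 2)) =
   \sum_(t < n | t != s) ((C (q t) - C (j t)%:R * X t) ^+ 2
            + C (k - j t)%:R * (C (N ^+ 2) - X t ^+ 2)).
  by apply: eq_bigr => t /negPf ts; rewrite /q' /j' ts.
rewrite !restE; set rest := \sum_(t < n | _) _.
have -> : (k - j s)%:R = (k - (j s).+1)%:R + 1 :> R.
  by rewrite natr1 subnS prednK // subn_gt0.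
have -> : (j s).+1%:R = (j s)%:R + 1 :> R by rewrite natr1.
congr T; rewrite XE; ring.
Qed.

Lemma preorder_cube (f : P) (c : R) : 0 < c ->
  (forall x, cube N x -> c <= ev x f) -> T f.
Proof.
move=> c0 fc; have [L L0 hL] := preorder_lipschitz f.
have cn : c != 0 by rewrite gt_eqF.
pose D := L / (2 * c).
have D0 : 0 <= D by rewrite divr_ge0 // mulr_ge0 // ltW.
have Tf x : cube N x -> T (f - C (c / 2) + C D * sqdist x).
  move=> hx; have := hL x hx; have := fc x hx; set v := ev x f => vc.
  (* Completing the square in f - v turns the Lipschitz bound on (f - v)^2 into a lower bound for f;
     this fixes [D]. *)
  have -> : f - C (c / 2) + C D * sqdist x = C (v - c) +
    C (c / 2) * (1 + C c^-1 * (f - C v)) ^+ 2 +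
     C (2 * c)^-1 * (C L * sqdist x - (f - C v) ^+ 2).
    have e1 : C c^-1 * C c = 1 by rewrite -mpolyCM mulVf.
    have e2 : C (2 * c)^-1 = C 2^-1 * C c^-1 by rewrite -mpolyCM invfM.
    have e3 : C 2^-1 * 2 = 1 by rewrite -(mpolyC_nat n R 2) -mpolyCM mulVf ?mpolyC1.
    have -> : C (c / 2) = C c * C 2^-1 by rewrite mpolyCM.
    have -> : C D = C L * C (2 * c)^-1 by rewrite /D mpolyCM.
    rewrite e2 mpolyCB; set ci := C c^-1 in e1 *; set h := C 2^-1 in e3 *.
    have eF : (f - C v) = (ci * C c) * (h * 2) * (f - C v) by rewrite e1 e3 !mul1r.
    transitivity (C v - C c + (h * 2) * C c - C c * h + (f - C v) * (ci * C c) * (h * 2)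
      + C L * (h * ci) * sqdist x); first by rewrite e1 e3; ring.
    transitivity (C v - C c + (h * 2) * C c - C c * h + (f - C v) * (ci * C c) * (h * 2)
      + C L * (h * ci) * sqdist x + (ci * C c - 1) * ci * h * (f - C v) ^+ 2).
      by rewrite e1 subrr !mul0r addr0.
    ring.
  move=> h; apply: TD; [apply: TD|].
  - by apply: preorderC; rewrite subr_ge0.
  - by apply: TM => //; apply: preorderC; rewrite divr_ge0 // ltW.
  - by apply: TM => //; apply: preorderC; rewrite invr_ge0 mulr_ge0 // ltW.
(* After rescaling by k the end point of the walk has variance at most n N^2 / k, so this k makes
   the loss at most c / 2. *)
pose k := (Num.truncn (D * n%:R * N ^+ 2 / (c / 2))).+1.
have kn0 : k%:R != 0 :> R by rewrite pnatr_eq0.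
have kD : D / k%:R * n%:R * N ^+ 2 <= c / 2.
  have : D * n%:R * N ^+ 2 / (c / 2) <= k%:R by rewrite ltW // truncnS_gt.
  rewrite ler_pdivrMr ?divr_gt0 // => h.
  have -> : D / k%:R * n%:R * N ^+ 2 = D * n%:R * N ^+ 2 / k%:R by ring.
  by rewrite ler_pdivrMr ?ltr0n // (le_trans h) // mulrC.
have := @preorder_walk f D (c / 2) k isT D0 Tf _ (fun=> 0%N) (fun=> 0)
  (fun=> leq0n k) erefl.
have q0 : forall s : 'I_n, `|0 : R| <= 0%:R * N by move=> s; rewrite normr0 mul0r.
move=> /(_ q0).
under eq_bigr do rewrite mpolyC0 mul0r subr0 expr0n /= add0r subn0.
rewrite -mulr_sumr sumrB sumr_const card_ord -/k => h.
have -> : f = f - C (c / 2) + C (D / k%:R ^+ 2) *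
   (C k%:R * (C (N ^+ 2) *+ n - \sum_(s < n) X s ^+ 2)) +
   C (c / 2 - D / k%:R * n%:R * N ^+ 2) + C (D / k%:R) * \sum_(s < n) X s ^+ 2.
  have -> : C (D / k%:R ^+ 2) = C (D / k%:R) * C k%:R^-1.
    by rewrite -mpolyCM expr2 invfM mulrA.
  have e : C k%:R^-1 * C k%:R = 1 by rewrite -mpolyCM mulVf.
  rewrite mulrA -[C _ * C _ * C _]mulrA e mulr1 -[_ *+ n]mulr_natr.
  ring.
apply: TD; [apply: TD => //|].
- by apply: preorderC; rewrite subr_ge0.
- apply: TM; last exact: preorder_sum.
  by apply: preorderC; rewrite divr_ge0.
Qed.

End Preordering.

(** * Putinar's theorem for polytopes *)

Section Positivity.
Variables (R : realType) (n : nat).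
Local Notation P := {mpoly R[n]}.
Local Notation C := (@mpolyC n R).
Local Notation X := (fun s : 'I_n => @mpolyX n R (mnm1 s)).

Definition issos (p : P) := exists s : seq P, p = \sum_(q <- s) q ^+ 2.

Lemma issos_sqr p : issos (p ^+ 2).
Proof. by exists [:: p]; rewrite big_seq1. Qed.

Lemma issos0 : issos 0.
Proof. by exists [::]; rewrite big_nil. Qed.

Lemma issosD p q : issos p -> issos q -> issos (p + q).
Proof. by move=> [s ->] [t ->]; exists (s ++ t); rewrite big_cat. Qed.

Lemma issos_sum (I : Type) (r : seq I) (Q : pred I) (f : I -> P) :
  (forall i, Q i -> issos (f i)) -> issos (\sum_(i <- r | Q i) f i).
Proof. by move=> h; elim/big_ind: _ => //; [exact: issos0|exact: issosD]. Qed.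

Lemma issosM p q : issos p -> issos q -> issos (p * q).
Proof.
move=> [s ->] [t ->]; rewrite mulr_suml; apply: issos_sum => a _.
rewrite mulr_sumr; apply: issos_sum => b _.
by rewrite -exprMn; exact: issos_sqr.
Qed.

Lemma issosC c : 0 <= c -> issos (C c).
Proof. by move=> c0; rewrite -(sqr_sqrtr c0) rmorphXn; exact: issos_sqr. Qed.

Lemma issos_ge0 p x : issos p -> 0 <= ev x p.
Proof.
by move=> [s ->]; rewrite ev_sum sumr_ge0 // => q _; rewrite evXn sqr_ge0.
Qed.

Definition qmodule (M : P -> Prop) :=
  [/\ M 1, forall p q, M p -> M q -> M (p + q)
    & forall p q, M q -> M (p ^+ 2 * q)].

Section QModule.
Variables (M : P -> Prop) (qM : qmodule M).

Lemma qmoduleD p q : M p -> M q -> M (p + q).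
Proof. by case: qM => _ + _; exact. Qed.

Lemma qmodule_sqrM p q : M q -> M (p ^+ 2 * q).
Proof. by case: qM => _ _; exact. Qed.

Lemma qmodule_sqr p : M (p ^+ 2).
Proof. by rewrite -[_ ^+ 2]mulr1; apply: qmodule_sqrM; case: qM. Qed.

Lemma qmodule0 : M 0.
Proof. by have := qmodule_sqr 0; rewrite expr0n. Qed.

Lemma qmodule_sum (I : Type) (r : seq I) (Q : pred I) (f : I -> P) :
  (forall i, Q i -> M (f i)) -> M (\sum_(i <- r | Q i) f i).
Proof. by move=> h; elim/big_ind: _ => //; [exact: qmodule0|exact: qmoduleD]. Qed.

Lemma qmodule_sosM p q : issos p -> M q -> M (p * q).
Proof.
move=> [s ->] Mq; rewrite mulr_suml.
by apply: qmodule_sum => a _; exact: qmodule_sqrM.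
Qed.

Lemma qmodule_sos p : issos p -> M p.
Proof. by move=> h; rewrite -[p]mulr1; apply: qmodule_sosM => //; case: qM. Qed.

Lemma qmoduleC c : 0 <= c -> M (C c).
Proof. by move=> /issosC/qmodule_sos. Qed.

Lemma qmoduleZ c p : 0 <= c -> M p -> M (C c * p).
Proof. by move=> /issosC/qmodule_sosM; apply. Qed.

(* The preordering generated by the single element b is {s0 + s1 b}: products of
   its elements stay in M, which fails for the linear constraints themselves. *)
Lemma qmodule_cube (N c : R) (f : P) : 0 < N -> 0 < c ->
  M (C (N ^+ 2) - \sum_s X s ^+ 2) -> (forall x, cube N x -> c <= ev x f) -> M f.
Proof.
set b := C _ - _ => N0 c0 Mb fc.
pose T p := exists s0 s1, [/\ issos s0, issos s1 & p = s0 + s1 * b].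
suff [s0 [s1 [h0 h1 ->]]] : T f.
  by apply: qmoduleD; [exact: qmodule_sos|exact: qmodule_sosM].
have Tsos p : issos p -> T p.
  by move=> h; exists p, 0; split; [|exact: issos0|rewrite mul0r addr0].
have TD p q : T p -> T q -> T (p + q).
  move=> [s0 [s1 [h0 h1 ->]]] [t0 [t1 [g0 g1 ->]]].
  exists (s0 + t0), (s1 + t1); split; [exact: issosD|exact: issosD|ring].
have TM p q : T p -> T q -> T (p * q).
  move=> [s0 [s1 [h0 h1 ->]]] [t0 [t1 [g0 g1 ->]]].
  exists (s0 * t0 + b ^+ 2 * (s1 * t1)), (s0 * t1 + s1 * t0); split; last ring.
    apply: issosD; first exact: issosM.
    by apply: issosM; [exact: issos_sqr|exact: issosM].
  by apply: issosD; exact: issosM.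
have Tsqr p : T (p ^+ 2) by apply: Tsos; exact: issos_sqr.
have TC d : 0 <= d -> T (C d) by move=> d0; apply: Tsos; exact: issosC.
have N2 : C (2 * N)^-1 * C N * 2 = 1.
  rewrite -(mpolyC_nat n R 2) -!mpolyCM -mulrA [N * 2]mulrC mulVf ?mpolyC1 //.
  by rewrite mulf_neq0 ?gt_eqF.
have N2i : 0 <= (2 * N)^-1 by rewrite invr_ge0 mulr_ge0 // ltW.
have Tbox s : T (C (N ^+ 2) - X s ^+ 2).
  exists (\sum_(t < n | t != s) X t ^+ 2), 1; split.
  - by apply: issos_sum => t _; exact: issos_sqr.
  - by rewrite -(mpolyC1 n R); exact: issosC.
  - by rewrite /b [\sum_s _](bigD1 s) //=; ring.
have Tlin e s : e ^+ 2 = 1 -> T (C N + C e * X s).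
  move=> e1; have ee : C e ^+ 2 = 1 by rewrite [LHS]expr2 -mpolyCM -expr2 e1 mpolyC1.
  (* Since e^2 = 1, the sum in parentheses is 2N (N + e X_s). *)
  have -> : C N + C e * X s =
      C (2 * N)^-1 * ((C N + C e * X s) ^+ 2 + (C (N ^+ 2) - X s ^+ 2)).
    have -> : (C N + C e * X s) ^+ 2 + (C (N ^+ 2) - X s ^+ 2) =
      2 * C N * (C N + C e * X s) + (C e ^+ 2 - 1) * X s ^+ 2 by ring.
    rewrite ee subrr mul0r addr0.
    by rewrite -[LHS]mul1r -[X in X * _ = _]N2; ring.
  by apply: TM; [exact: TC|exact: TD].
apply: (@preorder_cube _ _ T N N0 TD TM Tsqr _ _ f c c0 fc) => s.
  by have := Tlin 1 s; rewrite mpolyC1 mul1r expr1n; exact.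
by have := Tlin (-1) s; rewrite mpolyCN mpolyC1 mulN1r sqrrN expr1n; exact.
Qed.

(** r'^2 - X_s^2 is (r' - X_s)^2 (r' + X_s) + (r' + X_s)^2 (r' - X_s) divided by 2r', where every
    product has a square factor. Taking r' = r + 1 keeps the divisor nonzero when r = 0. *)
Lemma qmodule_ball r : 0 <= r ->
  (forall s, M (C r + X s)) -> (forall s, M (C r - X s)) ->
  exists2 N, r < N & M (C (N ^+ 2) - \sum_s X s ^+ 2).
Proof.
move=> r0 hp hm; pose r' := r + 1.
have r'0 : 0 < r' by rewrite ltr_wpDl.
have hp' s : M (C r' + X s).
  by rewrite mpolyCD addrAC; apply: qmoduleD => //; exact: qmoduleC.
have hm' s : M (C r' - X s).
  by rewrite mpolyCD addrAC; apply: qmoduleD => //; exact: qmoduleC.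
have r2 : C (2 * r')^-1 * C r' * 2 = 1.
  rewrite -(mpolyC_nat n R 2) -!mpolyCM -mulrA [r' * 2]mulrC mulVf ?mpolyC1 //.
  by rewrite mulf_neq0 ?gt_eqF.
have hb s : M (C (r' ^+ 2) - X s ^+ 2).
  have -> : C (r' ^+ 2) - X s ^+ 2 = C (2 * r')^-1 *
      ((C r' - X s) ^+ 2 * (C r' + X s) + (C r' + X s) ^+ 2 * (C r' - X s)).
    by rewrite -[LHS]mul1r -[X in X * _ = _]r2; ring.
  apply: qmoduleZ; first by rewrite invr_ge0 mulr_ge0 // ltW.
  by apply: qmoduleD; exact: qmodule_sqrM.
exists (r' * n.+1%:R).
  rewrite (@lt_le_trans _ _ r') //; first by rewrite ltrDl.
  by rewrite ler_peMr // ?ler1n // ltW.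
have -> : C ((r' * n.+1%:R) ^+ 2) - \sum_s X s ^+ 2 =
    C (r' ^+ 2 * (n.+1%:R ^+ 2 - n%:R)) + \sum_s (C (r' ^+ 2) - X s ^+ 2).
  rewrite sumrB sumr_const card_ord -mpolyCMn addrA -mpolyCD.
  by rewrite -[r' ^+ 2 *+ n]mulr_natr; congr (C _ - _); ring.
apply: qmoduleD; last exact: qmodule_sum.
apply: qmoduleC; rewrite mulr_ge0 ?sqr_ge0 // subr_ge0 -natrX ler_nat.
by rewrite (@leq_trans n.+1) // -[leqLHS]expn1 leq_pexp2l.
Qed.

End QModule.

Lemma ev_continuous (p : P) : continuous (fun x : 'rV[R]_n => ev x p).
Proof.
elim/mpoly_alg_ind: p => [c|s|p q hp hq|p q hp hq] x.
- rewrite (_ : (fun y => _) = cst c); first exact: cst_continuous.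
  by apply/funext => y; rewrite evC.
- rewrite (_ : (fun y => _) = (fun y : 'rV[R]_n => y ord0 s)).
    exact: coord_continuous.
  by apply/funext => y; rewrite evX.
- rewrite (_ : (fun y => _) = (fun y : 'rV[R]_n => ev y p + ev y q)).
    by exact: (@continuousD _ _ _ _ _ x (hp x) (hq x)).
  by apply/funext => y; rewrite evD.
- rewrite (_ : (fun y => _) = (fun y : 'rV[R]_n => ev y p * ev y q)).
    by exact: (@continuousM _ _ _ _ x (hp x) (hq x)).
  by apply/funext => y; rewrite evM.
Qed.

Lemma cube_pos (N : R) (phi : 'rV[R]_n -> R) : 0 <= N -> continuous phi ->
  (forall x, cube N x -> 0 < phi x) ->
  exists2 c, 0 < c & forall x, cube N x -> c <= phi x.
Proof.
move=> N0 cphi phi0.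
have cK : compact [set x : 'rV[R]_n | forall s, x ord0 s \in `[- N, N]].
  apply: (@rV_compact _ _ (fun=> `[- N, N]%classic)) => _.
  exact: segment_compact.
have KE x : [set x : 'rV[R]_n | forall s, x ord0 s \in `[- N, N]] x <-> cube N x.
  by split=> h s; have := h s; rewrite ?in_itv /= ler_norml.
have K0 : [set x : 'rV[R]_n | forall s, x ord0 s \in `[- N, N]] !=set0.
  by exists 0 => /= s; rewrite mxE in_itv /= oppr_le0 N0.
have [z zK zmin] := EVT_min_rV K0 cK (continuous_subspaceT cphi).
exists (phi z); first by apply/phi0/KE; rewrite inE in zK.
by move=> x /KE h; apply: zmin; rewrite inE.
Qed.

(** m (1 - t)^m is at most the geometric sum of the (1 - t)^i for i < m, whose product with t is 1 -
    (1 - t)^m. *)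
Lemma pow_decay (t : R) m : 0 <= t <= 1 -> (1 - t) ^+ m * t * m%:R <= 1.
Proof.
move=> /andP[t0 t1]; have y0 : 0 <= 1 - t by rewrite subr_ge0.
have y1 : 1 - t <= 1 by rewrite gerBl.
have E : (\sum_(i < m) (1 - t) ^+ i) * t = 1 - (1 - t) ^+ m.
  have := subrX1 (1 - t) m; set S := \sum_(i < m) _ => h.
  by rewrite -[RHS]opprB h; ring.
apply: (@le_trans _ _ (1 - (1 - t) ^+ m)); last by rewrite gerBl exprn_ge0.
rewrite -E mulrAC ler_wpM2r // mulr_natr -[X in _ *+ X](card_ord m) -sumr_const.
by apply: ler_sum => i _; apply: ler_wiXn2l => //; rewrite ltnW.
Qed.

Section Polytope.
Variables (J : finType) (al : J -> R) (u : J -> 'rV[R]_n).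
Let g j := aff (al j) (u j).
Definition polytope (x : 'rV[R]_n) := forall j, 0 <= ev x (g j).
Local Notation K := polytope.
Variables (M : P -> Prop) (r : R) (x0 : 'rV[R]_n).
Hypotheses (qM : qmodule M) (Mg : forall j, M (g j)).
Hypotheses (Kr : forall x, K x -> cube r x) (Kx0 : K x0).

Lemma qmodule_aff (be : R) (v : 'rV[R]_n) :
  (forall x, K x -> 0 <= ev x (aff be v)) -> M (aff be v).
Proof.
move=> h; have [c0 [c [c00 cj ->]]] := farkas_aff Kx0 h.
apply: qmoduleD => //; first exact: qmoduleC.
by apply: qmodule_sum => // j _; exact: (qmoduleZ qM (cj j) (Mg j)).
Qed.

Lemma polytope_ball : exists2 N, 0 < N &
  (forall x, K x -> cube N x) /\ M (C (N ^+ 2) - \sum_s X s ^+ 2).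
Proof.
(* For n = 0 the cube hypothesis puts no sign on [r], hence the absolute value. *)
have rr : r <= `|r| by exact: ler_norm.
have [||N rN MN] := qmodule_ball qM (normr_ge0 r).
- move=> s; have := @qmodule_aff `|r| (1 *: delta_mx ord0 s).
  rewrite /aff lin_scale lin_delta mpolyC1 mul1r; apply=> x /Kr/(_ s);
    rewrite !evE ler_norml.
  by move=> /andP[? ?]; lra.
- move=> s; have := @qmodule_aff `|r| (-1 *: delta_mx ord0 s).
  rewrite /aff lin_scale lin_delta mpolyCN mpolyC1 mulN1r; apply=> x /Kr/(_ s);
    rewrite !evE ler_norml.
  by move=> /andP[? ?]; lra.
exists N; first by rewrite (le_lt_trans _ rN).
by split=> // x /Kr h s; rewrite (le_trans (h s)) // (le_trans rr) // ltW.
Qed.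

(** The maximum of [phi] and of the largest violation of a constraint is continuous and positive on
    the compact cube. *)
Lemma polytope_gap (N : R) (phi : 'rV[R]_n -> R) : 0 <= N -> continuous phi ->
  (forall x, K x -> 0 < phi x) ->
  exists2 c, 0 < c &
    forall x, cube N x -> c <= phi x \/ exists j, ev x (g j) <= - c.
Proof.
move=> N0 cphi phi0.
(* The floor -1 gives a value for empty [J], and it never reaches the positive bound [c]. *)
pose mg x := \big[Num.max/-1]_j (- ev x (g j)).
have cmg : continuous mg.
  apply: continuous_big; first exact: max_continuous.
  move=> j _ x; apply: (@continuousN _ _ _ (fun x => ev x (g j))).
  exact: ev_continuous.
have [||c c0 hc] := @cube_pos N (phi \max mg) N0.
- exact: max_fun_continuous.
- move=> x _; rewrite /= lt_max.
  have [Kx|/existsNP[j /negP]] := pselect (K x); first by rewrite phi0.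
  rewrite -ltNge => gj; apply/orP; right; apply: (@lt_le_trans _ _ (- ev x (g j))).
    by rewrite oppr_gt0.
  exact: (@le_bigmax _ _ _ _ (fun j => - ev x (g j))).
exists c => // x /hc; rewrite /= le_max => /orP[|/bigmax_geP[|[j _]]]; first by left.
  by move=> h; exfalso; lra.
by rewrite lerNr => h; right; exists j.
Qed.

Lemma polytope_pos (phi : 'rV[R]_n -> R) : continuous phi ->
  (forall x, K x -> 0 < phi x) -> exists2 c, 0 < c & forall x, K x -> c <= phi x.
Proof.
move=> cphi phi0; have [N N0 [KN _]] := polytope_ball.
have [c c0 hc] := polytope_gap (ltW N0) cphi phi0.
exists c => // x Kx; have [//|[j gj]] := hc x (KN x Kx).
by have := Kx j; rewrite leNgt (le_lt_trans gj) // oppr_lt0.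
Qed.

(** If the supremum s were not attained, s - f would be positive on K, hence at least some c > 0
    there, against the choice of s. *)
Lemma polytope_max (f : P) : exists2 z, K z & forall x, K x -> ev x f <= ev z f.
Proof.
have [N N0 [KN _]] := polytope_ball.
have [B B0 fB] := cube_bounded N f.
pose S := [set ev x f | x in [set x | K x]].
have S0 : S (ev x0 f) by exists x0.
have supS : has_sup S.
  split; first by exists (ev x0 f).
  exists B => _ [x Kx <-]; exact: le_trans (ler_norm _) (fB x (KN x Kx)).
apply: contrapT => /forall2NP h.
have [||c c0 hc] := @polytope_pos (fun x => ev x (C (sup S) - f)).
- exact: ev_continuous.
- move=> x Kx; rewrite evB evC subr_gt0 lt_neqAle sup_upper_bound ?andbT //;
  last by exists x.
  apply/eqP => fx; case: (h x) => //; apply=> y Ky.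
  by rewrite fx sup_upper_bound //; exists y.
have [_ [x Kx <-]] := sup_adherent c0 supS.
by have := hc x Kx; rewrite evB evC; lra.
Qed.

Theorem putinar (f : P) : (forall x, K x -> 0 < ev x f) -> M f.
Proof.
move=> f0; have [N N0 [KN MN]] := polytope_ball.
have [B B0 fB] := cube_bounded N f.
have /choice[G hG] : forall j, exists G, 0 <= G /\ forall x, cube N x -> `|ev x (g j)| <= G.
  by move=> j; have [G ? ?] := cube_bounded N (g j); exists G.
(* [D] bounds all |g_j| on the cube, so that g_j / D stays in [-1, 1]. *)
pose D := 1 + \sum_j G j.
have D1 : 1 <= D by rewrite lerDl sumr_ge0 // => j _; case: (hG j).
have D0 : 0 < D by apply: lt_le_trans D1.
have gD j x : cube N x -> `|ev x (g j)| <= D.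
  move=> hx; case: (hG j) => _ /(_ x hx) h; apply: le_trans h _.
  rewrite /D (bigD1 j) //= addrCA lerDl addr_ge0 // sumr_ge0 // => i _.
  by case: (hG i).
have [c c0 hc] := polytope_gap (ltW N0) (@ev_continuous f) f0.
pose c' := c / D.
have c'0 : 0 < c' by rewrite divr_gt0.
have cc' : c' <= c by rewrite ler_pdivrMr // ler_peMr // ltW.
pose h j := C D^-1 * g j.
have Mh j : M (h j) by apply: qmoduleZ => //; rewrite invr_ge0 ltW.
have h1 j x : cube N x -> `|ev x (h j)| <= 1.
  move=> hx; rewrite evM evC normrM gtr0_norm ?invr_gt0 // ler_pdivrMl // mulr1.
  exact: gD.
(* Where some h_j <= -c', the penalty la c' = B + 1 + c' outweighs f >= -B. *)
pose la := (B + 1 + c') / c'.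
have la0 : 0 < la by rewrite divr_gt0 // ltr_wpDl // addr_ge0.
(* By [pow_decay] the terms of [S] are at most 1 / (2k) on the cube, so this k keeps [la] times any
   partial sum at most c' / 2. *)
pose k := (Num.truncn (la * #|J|%:R / c')).+1.
have kla : la * #|J|%:R / k%:R <= c'.
  rewrite ler_pdivrMr ?ltr0n // [leRHS]mulrC -ler_pdivrMr //.
  by rewrite ltW // truncnS_gt.
pose S := \sum_j (1 - h j) ^+ (2 * k) * h j.
have -> : f = (f - C la * S) + C la * S by rewrite subrK.
apply: qmoduleD => //; last first.
  apply: qmoduleZ => //; first exact: ltW.
  by apply: qmodule_sum => // j _; rewrite mulnC exprM; exact: qmodule_sqrM.
pose e j (x : 'rV[R]_n) := ev x ((1 - h j) ^+ (2 * k) * h j).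
have k2 : 0 < (2 * k)%:R :> R by rewrite ltr0n.
(* Where h_j <= 0 the factor (1 - h_j)^(2k) is at least 1 and amplifies the violation. *)
have eneg j x : ev x (h j) <= 0 -> e j x <= ev x (h j).
  move=> hn; rewrite /e evM evXn evB ev1 -subr_ge0 -[X in _ <= X - _]mul1r -mulrBl.
  by rewrite mulr_le0 // subr_le0 exprn_ege1 // lerDl oppr_ge0.
have epos j x : cube N x -> e j x <= (2 * k%:R)^-1.
  move=> hx; have [hp|hn] := leP 0 (ev x (h j)); last first.
    by apply: le_trans (eneg _ _ (ltW hn)) _;
      rewrite (le_trans (ltW hn)) // invr_ge0 mulr_ge0.
  have := h1 j x hx; rewrite ger0_norm // => h1x.
  rewrite /e evM evXn evB ev1 -[leRHS]mul1r ler_pdivlMr ?mulr_gt0 ?ltr0n // -natrM.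
  by apply: pow_decay; rewrite hp h1x.
have sumk (Q : pred J) x : cube N x -> \sum_(j | Q j) e j x <= #|J|%:R / (2 * k%:R).
  move=> hx; apply: (@le_trans _ _ (\sum_(j | Q j) (2 * k%:R)^-1)).
    by apply: ler_sum => j _; exact: epos.
  by rewrite sumr_const -[leLHS]mulr_natl ler_wpM2r ?invr_ge0 ?mulr_ge0 // ler_nat max_card.
have lak : la * (#|J|%:R / (2 * k%:R)) <= c' / 2.
  have -> : la * (#|J|%:R / (2 * k%:R)) = la * #|J|%:R / k%:R / 2.
    by field; rewrite pnatr_eq0.
  by rewrite ler_pM2r // invr_gt0.
have c'2 : 0 < c' / 2 by rewrite divr_gt0.
apply: (qmodule_cube qM N0 c'2 MN) => x hx.
rewrite evB evM evC ev_sum -/(e _ x).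
have [fx|[j0 gj0]] := hc x hx.
  have := ler_wpM2l (ltW la0) (sumk xpredT x hx).
  rewrite /e => ?; lra.
have hj0 : ev x (h j0) <= - c'.
  by rewrite evM evC mulrC ler_pdivrMr // mulNr divfK // gt_eqF.
rewrite (bigD1 j0) //=.
have e0 : e j0 x <= - c' by apply: le_trans (eneg _ _ _) (hj0);
  rewrite (le_trans hj0) // oppr_le0 ltW.
have := ler_wpM2l (ltW la0) e0.
have := ler_wpM2l (ltW la0) (sumk (fun j => j != j0) x hx).
have -> : la * - c' = - (B + 1 + c') by rewrite mulrN divfK // gt_eqF.
have := fB x hx; rewrite ler_norml => /andP[? _].
rewrite /e mulrDr; set s := la * \sum_(j | _) _; set s' := la * ev _ _ => ? ?.
lra.
Qed.

(* On K, where 0 <= W < N, the peak is 1 at the zeros of W and tends to 0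
   elsewhere as k grows. *)
Definition peak (N : R) (W : P) (k : nat) : P := (1 - C N^-1 * W) ^+ k.

(** The quotient of 1 - [peak]^2 by W, as a geometric sum. *)
Definition peak_quo (N : R) (W : P) (k : nat) : P :=
  C N^-1 * \sum_(i < 2 * k) (1 - C N^-1 * W) ^+ i.

Lemma peakE N W k : 1 - peak N W k ^+ 2 = W * peak_quo N W k.
Proof.
rewrite /peak -exprM mulnC -opprB subrX1 /peak_quo.
by set S := \sum_(i < _) _; ring.
Qed.

(** Where F is at least some c > 0, [peak_quo] >= 1 / N keeps the first term above c / N while the
    peak decays; where F < c, the bound [th] >= c carries the sum. *)
Lemma peak_pos (F W th : P) : (forall x, K x -> 0 <= ev x F) ->
  (forall x, K x -> 0 <= ev x W) ->
  (forall x, K x -> 0 < ev x F -> 0 < ev x W) ->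
  (forall x, K x -> ev x F <= 0 -> 0 < ev x th) ->
  forall N, (forall x, K x -> ev x W < N) -> 0 < N ->
  exists k0, forall k, (k0 <= k)%N -> forall x, K x ->
    0 < ev x (peak_quo N W k * F + peak N W k ^+ 2 * th).
Proof.
move=> F0 W0 FW Fth N WN N0.
have [L L0 [KL _]] := polytope_ball.
have [Th Th0 thB] := cube_bounded L th.
have [||c c0 hc] := @polytope_pos ((fun x => ev x F) \max (fun x => ev x th)).
- by apply: max_fun_continuous; exact: ev_continuous.
- by move=> x Kx; rewrite lt_max; have [//|/(Fth x Kx) ->] := ltP 0 (ev x F); rewrite orbT.
(* Where F >= c the second function is at most 0, so W >= d there. *)
have [||d d0 hd] := @polytope_pos ((fun x => ev x W) \max (fun x => ev x (C c - F))).
- by apply: max_fun_continuous; exact: ev_continuous.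
- move=> x Kx; rewrite /= lt_max evB evC subr_gt0; apply/orP.
  have [h|h] := ltP (ev x F) c; first by right.
  by left; apply: FW => //; exact: lt_le_trans h.
(* Where W >= d, [pow_decay] gives peak^2 <= N / (k d), so from [k0] on the second term stays above
   - c / N. *)
pose k0 := (Num.truncn (Th * N ^+ 2 / (d * c))).+1.
exists k0 => k k0k x Kx; rewrite evD evM evM evXn.
have Wx0 : 0 <= N^-1 * ev x W by rewrite mulr_ge0 ?W0 // invr_ge0 ltW.
have Wx1 : N^-1 * ev x W < 1 by rewrite ltr_pdivrMl // mulr1 WN.
have y0 : 0 < 1 - N^-1 * ev x W by rewrite subr_gt0.
have bE i : ev x ((1 - C N^-1 * W) ^+ i) = (1 - N^-1 * ev x W) ^+ i.
  by rewrite evXn evB ev1 evM evC.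
rewrite /peak bE.
have kp : (0 < k)%N by apply: leq_trans k0k.
have q1 : N^-1 <= ev x (peak_quo N W k).
  rewrite evM evC ler_peMr ?invr_ge0 ?(ltW N0) // ev_sum.
  have : (0 < 2 * k)%N by rewrite muln_gt0.
  case: (2 * k)%N => // m _; rewrite big_ord_recl bE expr0 lerDl sumr_ge0 // => i _.
  by rewrite bE exprn_ge0 // ltW.
have [Fc|Fc] := leP c (ev x F); last first.
  have := hc x Kx; rewrite le_max leNgt Fc /= => thc.
  rewrite ltr_wpDl //.
    by rewrite mulr_ge0 ?F0 // (le_trans _ q1) // invr_ge0 ltW.
  by rewrite mulr_gt0 ?exprn_gt0 // (lt_le_trans c0).
have := hd x Kx; rewrite le_max evB evC => /orP[Wd|]; last by move=> ?; exfalso; lra.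
have := @pow_decay (N^-1 * ev x W) (2 * k).
rewrite Wx0 (ltW Wx1) => /(_ isT); rewrite mulnC exprM natrM.
have A0 : 0 < ((1 - N^-1 * ev x W) ^+ k) ^+ 2 by rewrite !exprn_gt0.
move: A0; set A := (_ ^+ k) ^+ 2 => A0 hA.
have kk : Th * N ^+ 2 < k%:R * (d * c).
  rewrite -ltr_pdivrMr ?mulr_gt0 //; apply: lt_le_trans (truncnS_gt _) _.
  by rewrite ler_nat.
have hA' : A * (k%:R * d) <= N.
  have : A * (k%:R * d) <= A * (k%:R * ev x W).
    by rewrite ler_wpM2l ?(ltW A0) // ler_wpM2l.
  move=> /le_trans; apply; move: hA.
  have -> : A * (N^-1 * ev x W) * (k%:R * 2) = A * (k%:R * ev x W) * 2 / N by ring.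
  rewrite ler_pdivrMr // mul1r.
  have Wp : 0 <= ev x W by exact: W0.
  have : 0 <= A * (k%:R * ev x W) by rewrite mulr_ge0 ?(ltW A0) // mulr_ge0.
  lra.
have AT : A * Th * N < c.
  rewrite -(ltr_pM2r N0).
  apply: (@lt_le_trans _ _ (A * (k%:R * (d * c)))).
    have -> : A * Th * N * N = A * (Th * N ^+ 2) by ring.
    by rewrite ltr_pM2l.
  have -> : A * (k%:R * (d * c)) = A * (k%:R * d) * c by ring.
  by rewrite [leRHS]mulrC ler_wpM2r // ltW.
have AT' : A * Th < N^-1 * c by rewrite [ltRHS]mulrC ltr_pdivlMr.
have tB : - (A * Th) <= A * ev x th.
  rewrite -mulrN ler_wpM2l ?(ltW A0) //.
  by have := thB x (KL x Kx); rewrite ler_norml => /andP[].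
have qF : N^-1 * c <= ev x (peak_quo N W k) * ev x F.
  by apply: ler_pM => //; [rewrite invr_ge0 ltW|exact: ltW].
lra.
Qed.

End Polytope.
End Positivity.

(** * Nonnegative polynomials with finitely many zeros *)

Section Local.
Variables (R : realType) (n : nat).
Local Notation P := {mpoly R[n]}.
Local Notation C := (@mpolyC n R).
Local Notation X := (fun s : 'I_n => @mpolyX n R (mnm1 s)).

(** Hadamard's lemma. The values of the [Y s] at z are the partial derivatives of p at z, so
    first-order arguments can run without differentiation. *)
Lemma hadamard (z : 'rV[R]_n) (p : P) :
  exists Y, p = C (ev z p) + \sum_s (X s - C (z ord0 s)) * Y s.
Proof.
elim/mpoly_alg_ind: p => [c|t|p q [Y pE] [Y' qE]|p q [Y pE] [Y' qE]].
- exists (fun=> 0); rewrite evC big1 ?addr0 // => s _; exact: mulr0.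
- exists (fun s => if s == t then 1 else 0).
  rewrite evX (bigD1 t) //= eqxx big1 => [|s /negPf ->]; last exact: mulr0.
  by ring.
- exists (fun s => Y s + Y' s); rewrite {1}pE {1}qE evD mpolyCD.
  under [X in _ = _ + X]eq_bigr do rewrite mulrDr.
  by rewrite big_split /=; ring.
- exists (fun s => Y s * q + C (ev z p) * Y' s).
  under eq_bigr do rewrite mulrDr mulrA mulrCA.
  rewrite big_split /= -mulr_suml -mulr_sumr evM mpolyCM.
  have pS : \sum_s (X s - C (z ord0 s)) * Y s = p - C (ev z p).
    by apply/eqP; rewrite eq_sym subr_eq addrC -pE.
  have qS : \sum_s (X s - C (z ord0 s)) * Y' s = q - C (ev z q).
    by apply/eqP; rewrite eq_sym subr_eq addrC -qE.
  by rewrite pS qS; ring.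
Qed.

Lemma ev_sqdist (z x : 'rV[R]_n) :
  ev x (sqdist z) = \sum_s (x ord0 s - z ord0 s) ^+ 2.
Proof. by rewrite ev_sum; apply: eq_bigr => s _; rewrite evXn evB evX evC. Qed.

Lemma ev_sqdist_eq0 (z x : 'rV[R]_n) : (ev x (sqdist z) == 0) = (x == z).
Proof.
rewrite ev_sqdist psumr_eq0 => [|s _]; last exact: sqr_ge0.
apply/allP/eqP => [h|-> s _]; last by rewrite /= subrr expr0n.
apply/rowP => s; have := h s; rewrite mem_index_enum /= sqrf_eq0 subr_eq0.
by move=> /(_ isT)/eqP.
Qed.

(** Newton's scheme: a multiple of the product of the squared distances to the other points corrects
    the value at the new one. *)
Lemma interpolation (Z : seq 'rV[R]_n) (v : 'rV[R]_n -> R) :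
  exists p : P, {in Z, forall z, ev z p = v z}.
Proof.
elim: Z => [|z Z [p IH]]; first by exists 0.
have [zZ|zZ] := boolP (z \in Z).
  by exists p => t; rewrite inE => /predU1P[->|]; exact: IH.
pose w := \prod_(t <- Z) sqdist t.
have wE x : ev x w = \prod_(t <- Z) ev x (sqdist t) by rewrite /ev rmorph_prod.
have wz : ev z w != 0.
  rewrite wE prodf_seq_neq0; apply/allP => t tZ /=; apply: contra zZ.
  by rewrite ev_sqdist_eq0 => /eqP ->.
exists (p + C ((v z - ev z p) / ev z w) * w) => t; rewrite inE evD evM evC.
move=> /predU1P[->|tZ]; first by rewrite divfK // subrKC.
rewrite (_ : ev t w = 0) ?mulr0 ?addr0; first exact: IH.
apply/eqP; rewrite wE prodf_seq_eq0; apply/hasP; exists t => //=.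
by rewrite ev_sqdist_eq0.
Qed.

(** Induction on the stronger claim that 1/2 can be subtracted: 1 + y + y^2 S - 1/2 = (1 + y)^2 / 2
    + y^2 (S - 1/2). *)
Lemma issos_geometric (y : P) N : issos (\sum_(i < (2 * N).+1) y ^+ i).
Proof.
suff : issos (\sum_(i < (2 * N).+1) y ^+ i - C 2^-1).
  move=> h; rewrite -[X in issos X](subrK (C 2^-1)).
  by apply: issosD h _; apply: issosC; rewrite invr_ge0.
have h1 : C 2^-1 * 2 = 1 by rewrite -(mpolyC_nat n R 2) -mpolyCM mulVf ?mpolyC1.
elim: N => [|N IH].
  rewrite muln0 big_ord1 expr0 (_ : 1 - _ = C 2^-1); last by rewrite -h1; ring.
  by apply: issosC; rewrite invr_ge0.
have -> : (2 * N.+1).+1 = (2 * N).+3 by rewrite mulnS.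
rewrite 2!big_ord_recl /=.
have -> : \sum_(i < (2 * N).+1) y ^+ bump 0 (bump 0 i) =
    y ^+ 2 * \sum_(i < (2 * N).+1) y ^+ i.
  by rewrite mulr_sumr; apply: eq_bigr => i _; rewrite /bump !leq0n -exprD.
rewrite expr0 /bump leq0n expr1.
set S := \sum_(i < _) _ in IH *.
have -> : 1 + (y + y ^+ 2 * S) - C 2^-1 =
    C 2^-1 * (1 + y) ^+ 2 + y ^+ 2 * (S - C 2^-1).
  have -> : C 2^-1 * (1 + y) ^+ 2 = C 2^-1 * (1 + y ^+ 2) + (C 2^-1 * 2) * y by ring.
  by rewrite h1 -{1}h1; ring.
apply: issosD; apply: issosM => //; try exact: issos_sqr.
by apply: issosC; rewrite invr_ge0.
Qed.

Variables (J : finType) (al : J -> R) (u : J -> 'rV[R]_n).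
Let g j := aff (al j) (u j).
Local Notation K := (polytope al u).
Variables (M : P -> Prop) (r : R) (x0 : 'rV[R]_n).
Hypotheses (qM : qmodule M) (Mg : forall j, M (g j)).
Hypotheses (Kr : forall x, K x -> cube r x) (Kx0 : K x0).
Variable F : P.

(* F is, modulo M, a quadratic form in generators V of a power of the ideal of Z
   which is a positive multiple of the standard form at the points of Z. *)
Definition quadratic_at (Z : seq 'rV[R]_n) :=
  exists (T : finType) (V : T -> P) (m d : P) (o : T -> T -> P),
  [/\ M m,
      F = m + \sum_i V i ^+ 2 * d + \sum_i \sum_j V i * V j * o i j,
      forall z, z \in Z -> 0 < ev z d /\ forall i j, ev z (o i j) = 0,
      forall x, K x -> (forall i, ev x (V i) = 0) -> x \in Z
    & forall y, (forall z, z \in Z -> ev z y = 0) ->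
        exists e Y, y ^+ e = \sum_i V i * Y i].

(** Without points the ideal is the unit ideal, generated by 1, and F = 1^2 F. *)
Lemma quadratic_at_nil : quadratic_at [::].
Proof.
exists unit, (fun=> 1), 0, F, (fun _ _ => 0); split => //.
- exact: qmodule0 qM.
- rewrite [X in _ = _ + X]big1 => [|i _]; last first.
    by rewrite big1 // => j _; rewrite mulr0.
  by rewrite (bigD1 tt) //= big1 => [|[]//]; rewrite expr1n mul1r add0r !addr0.
- by move=> x _ /(_ tt)/eqP; rewrite ev1 oner_eq0.
- move=> y _; exists 0%N, (fun=> 1).
  by rewrite expr0 (bigD1 tt) //= big1 => [|[]//]; rewrite mulr1 addr0.
Qed.

(** The forms are glued along the products V1_i V2_j. Both W2 F and W1 F can be expressed in them,
    hence so can S F for S = A W2 + B W1. As S is 1 at the points, Q inverts it up to y^(2N+1),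
    where y = 1 - S. The remainder y^(2N+1) F is y F times the square of y^N, a combination of the
    products. *)
Lemma quadratic_at_cat Z1 Z2 : quadratic_at Z1 -> quadratic_at Z2 ->
  {in Z1, forall z, z \notin Z2} ->
  {in Z1 ++ Z2, forall z, K z /\ ev z F = 0} -> quadratic_at (Z1 ++ Z2).
Proof.
move=> [T1 [V1 [m1 [d1 [ o1 [Mm1 F1 do1 K1 gen1]]]]]].
move=> [T2 [V2 [m2 [d2 [ o2 [Mm2 F2 do2 K2 gen2]]]]]] disj KZ.
pose W1 := \sum_i V1 i ^+ 2; pose W2 := \sum_i V2 i ^+ 2.
have W0 (T : finType) (V : T -> P) x : 0 <= ev x (\sum_i V i ^+ 2).
  by rewrite issos_ge0 //; apply: issos_sum => i _; exact: issos_sqr.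
have Wpos (T : finType) (V : T -> P) x :
    ~ (forall i, ev x (V i) = 0) -> 0 < ev x (\sum_i V i ^+ 2).
  move=> h; rewrite lt_neqAle W0 andbT eq_sym; apply/negP => /eqP W.
  apply: h => i; apply/eqP; move: W => /eqP; rewrite ev_sum psumr_eq0.
    by move=> /allP/(_ i); rewrite mem_index_enum /= evXn sqrf_eq0 => ->.
  by move=> j _; rewrite evXn sqr_ge0.
have KZ1 z : z \in Z1 -> K z /\ ev z F = 0.
  by move=> zZ; apply: KZ; rewrite mem_cat zZ.
have KZ2 z : z \in Z2 -> K z /\ ev z F = 0.
  by move=> zZ; apply: KZ; rewrite mem_cat zZ orbT.
have W1pos z : z \in Z2 -> 0 < ev z W1.
  move=> zZ; apply: Wpos => /K1; have [Kz _] := KZ2 z zZ.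
  by move=> /(_ Kz)/disj; rewrite zZ.
have W2pos z : z \in Z1 -> 0 < ev z W2.
  move=> zZ; apply: Wpos => /K2; have [Kz _] := KZ1 z zZ.
  by move=> /(_ Kz); apply/negP/disj.
(* a^2 is to be 1 / W2 on Z1 and 0 on Z2, and b^2 to be 0 on Z1 and 1 / W1 on Z2, which makes S
   equal to 1 at all the points. *)
have [a aE] := interpolation (Z1 ++ Z2)
  (fun z => if z \in Z1 then Num.sqrt (ev z W2)^-1 else 0).
have [b bE] := interpolation (Z1 ++ Z2)
  (fun z => if z \in Z1 then 0 else Num.sqrt (ev z W1)^-1).
have a1 z : z \in Z1 -> ev z (a ^+ 2) = (ev z W2)^-1.
  move=> zZ; rewrite evXn aE ?mem_cat ?zZ // sqr_sqrtr // invr_ge0 ltW //.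
  exact: W2pos.
have b1 z : z \in Z1 -> ev z (b ^+ 2) = 0.
  by move=> zZ; rewrite evXn bE ?mem_cat ?zZ // expr0n.
have nZ1 z : z \in Z2 -> z \in Z1 = false.
  by move=> zZ; apply/negP => /disj; rewrite zZ.
have a2 z : z \in Z2 -> ev z (a ^+ 2) = 0.
  by move=> zZ; rewrite evXn aE ?mem_cat ?zZ ?orbT // nZ1 // expr0n.
have b2 z : z \in Z2 -> ev z (b ^+ 2) = (ev z W1)^-1.
  move=> zZ; rewrite evXn bE ?mem_cat ?zZ ?orbT // nZ1 // sqr_sqrtr //.
  by rewrite invr_ge0 ltW // W1pos.
move: (issos_sqr a) (issos_sqr b) a1 b1 a2 b2 {aE bE}.
move: (a ^+ 2) (b ^+ 2) => A B As Bs a1 b1 a2 b2.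
pose S := A * W2 + B * W1; pose y := 1 - S.
have y1 z : z \in Z1 -> ev z y = 0.
  move=> zZ; rewrite evB ev1 evD !evM a1 // b1 // mul0r addr0 mulVf ?subrr //.
  by rewrite gt_eqF // W2pos.
have y2 z : z \in Z2 -> ev z y = 0.
  move=> zZ; rewrite evB ev1 evD !evM a2 // b2 // mul0r add0r mulVf ?subrr //.
  by rewrite gt_eqF // W1pos.
have gen q : (forall z, z \in Z1 ++ Z2 -> ev z q = 0) ->
    exists e (Y : T1 * T2 -> P), q ^+ e = \sum_p V1 p.1 * V2 p.2 * Y p.
  move=> q0.
  have [z zZ|e1 [Y1 E1]] := gen1 q; first by apply: q0; rewrite mem_cat zZ.
  have [z zZ|e2 [Y2 E2]] := gen2 q; first by apply: q0; rewrite mem_cat zZ orbT.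
  exists (e1 + e2)%N, (fun p => Y1 p.1 * Y2 p.2); rewrite exprD E1 E2 big_distrlr /=.
  by rewrite pair_bigA /=; apply: eq_bigr => p _; ring.
have [N [Y yE]] : exists e (Y : T1 * T2 -> P), y ^+ e = \sum_p V1 p.1 * V2 p.2 * Y p.
  by apply: gen => z; rewrite mem_cat => /orP[/y1|/y2].
(* An odd number of terms makes [Q] a sum of squares. *)
pose Q := \sum_(i < (2 * N).+1) y ^+ i.
have Qsos : issos Q by exact: issos_geometric.
have SQ : S * Q = 1 - y ^+ (2 * N).+1.
  have := subrX1 y (2 * N).+1; rewrite -/Q => h.
  by rewrite -[RHS]opprB h /y; ring.
have Q1 z : ev z y = 0 -> ev z Q = 1.
  move=> yz; rewrite ev_sum big_ord_recl expr0 ev1 big1 ?addr0 // => i _.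
  by rewrite evXn yz expr0n.
pose V (p : T1 * T2) := V1 p.1 * V2 p.2.
have VW : \sum_p V p ^+ 2 = W1 * W2.
  rewrite /W1 /W2 big_distrlr /= pair_bigA; apply: eq_bigr => p _.
  by rewrite /V exprMn.
(* The Kronecker symbols turn W2 times the form in V1, and W1 times the form in V2, into forms in
   the products. The last coefficient vanishes at the points through its factor [y]. *)
exists (T1 * T2)%type, V, (Q * A * W2 * m1 + Q * B * W1 * m2),
  (Q * A * d1 + Q * B * d2),
  (fun p q => Q * A * ((p.2 == q.2)%:R * o1 p.1 q.1)
     + Q * B * ((p.1 == q.1)%:R * o2 p.2 q.2) + y * F * (Y p * Y q)).
split => //.
- have Ws (T : finType) (V' : T -> P) : issos (\sum_i V' i ^+ 2).
    by apply: issos_sum => i _; exact: issos_sqr.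
  apply: (qmoduleD qM); apply: (qmodule_sosM qM) => //.
    by do 2?apply: issosM => //; exact: Ws.
  by do 2?apply: issosM => //; exact: Ws.
- have pairE (G : T1 * T2 -> P) : \sum_p G p = \sum_i \sum_j G (i, j).
    by rewrite pair_bigA; apply: eq_bigr => -[].
  have h1 : \sum_p \sum_q V p * V q * ((p.2 == q.2)%:R * o1 p.1 q.1) =
      W2 * \sum_i \sum_j V1 i * V1 j * o1 i j.
    rewrite pairE mulr_sumr; apply: eq_bigr => i _.
    rewrite mulr_suml; apply: eq_bigr => j _.
    rewrite pairE mulr_sumr; apply: eq_bigr => i' _.
    rewrite (bigD1 j) //= big1 => [|j' /negPf jj'].
      by rewrite /V /= eqxx mulr1n; ring.
    by rewrite eq_sym jj' !(mul0r, mulr0).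
  have h2 : \sum_p \sum_q V p * V q * ((p.1 == q.1)%:R * o2 p.2 q.2) =
      W1 * \sum_i \sum_j V2 i * V2 j * o2 i j.
    rewrite pairE mulr_suml; apply: eq_bigr => i _.
    rewrite mulr_sumr; apply: eq_bigr => j _.
    rewrite pairE exchange_big mulr_sumr; apply: eq_bigr => j' _.
    rewrite (bigD1 i) //= big1 => [|i' /negPf ii'].
      by rewrite /V /= eqxx mulr1n; ring.
    by rewrite eq_sym ii' !(mul0r, mulr0).
  have h3 : \sum_p \sum_q V p * V q * (Y p * Y q) = y ^+ (2 * N).
    rewrite mulnC exprM yE expr2 big_distrlr /=; apply: eq_bigr => p _.
    by apply: eq_bigr => q _; rewrite /V; ring.
  have split3 : \sum_p \sum_q V p * V q * (Q * A * ((p.2 == q.2)%:R * o1 p.1 q.1)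
     + Q * B * ((p.1 == q.1)%:R * o2 p.2 q.2) + y * F * (Y p * Y q)) =
     Q * A * (W2 * \sum_i \sum_j V1 i * V1 j * o1 i j) +
     Q * B * (W1 * \sum_i \sum_j V2 i * V2 j * o2 i j) + y * F * y ^+ (2 * N).
    rewrite -h1 -h2 -h3 !mulr_sumr -!big_split /=; apply: eq_bigr => p _.
    by rewrite !mulr_sumr -!big_split /=; apply: eq_bigr => q _; ring.
  rewrite split3 -mulr_suml VW.
  have E1 : F - m1 - W1 * d1 = \sum_i \sum_j V1 i * V1 j * o1 i j.
    by rewrite {1}F1 -mulr_suml -/W1; ring.
  have E2 : F - m2 - W2 * d2 = \sum_i \sum_j V2 i * V2 j * o2 i j.
    by rewrite {1}F2 -mulr_suml -/W2; ring.
  rewrite -E1 -E2; transitivity ((S * Q + y ^+ (2 * N).+1) * F).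
    by rewrite SQ subrK mul1r.
  by rewrite exprS /S; ring.
- clearbody S y Q V W1 W2.
  move=> z; rewrite mem_cat => /orP[zZ|zZ].
    have [d1z o1z] := do1 z zZ; have [_ Fz] := KZ1 z zZ.
    have yz := y1 z zZ.
    rewrite !(evD, evM) Q1 // a1 // b1 // !(mulr0, mul0r) addr0 mul1r; split.
      by rewrite mulr_gt0 // invr_gt0 W2pos.
    by move=> i j; rewrite !(evD, evM) o1z yz b1 // !(mulr0, mul0r, addr0).
  have [d2z o2z] := do2 z zZ; have [_ Fz] := KZ2 z zZ.
  have yz := y2 z zZ.
  rewrite !(evD, evM) Q1 // a2 // b2 // !(mulr0, mul0r) add0r mul1r; split.
    by rewrite mulr_gt0 // invr_gt0 W1pos.
  by move=> i j; rewrite !(evD, evM) o2z yz a2 // !(mulr0, mul0r, addr0).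
- move=> x Kx Vx; rewrite mem_cat; apply/orP.
  have [h|/existsNP[i /eqP Vi]] := pselect (forall i, ev x (V1 i) = 0).
    by left; exact: K1.
  right; apply: K2 => // j; apply/eqP; have /eqP := Vx (i, j).
  by rewrite evM mulf_eq0 (negPf Vi).
Qed.

(** Since 1 - A^2 = W q, the polynomial F - A^2 m is the sum of the V_i^2 (q F + A^2 d) and of the
    A^2 V_i V_j o_ij. Polarization rewrites it in the squares (V_i ± V_j)^2 with coefficients q F +
    A^2 (d ± #|T| o_ij), up to a positive constant. *)
Lemma quadratic_at_qmodule Z : quadratic_at Z ->
  {in Z, forall z, ev z F = 0} -> (forall x, K x -> 0 <= ev x F) ->
  (forall x, K x -> ev x F = 0 -> x \in Z) -> M F.
Proof.
move=> [T [V [m [d [ o [Mm FE doZ KV _]]]]]] FZ F0 ZF.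
have [T0|T0] := posnP #|T|.
  rewrite FE !big1 ?addr0 // => [i|i] _; by have := fintype0 i T0.
pose W := \sum_i V i ^+ 2.
have W0 x : 0 <= ev x W.
  by rewrite issos_ge0 //; apply: issos_sum => i _; exact: issos_sqr.
have FW x : K x -> 0 < ev x F -> 0 < ev x W.
  move=> Kx Fx; rewrite lt_neqAle W0 andbT eq_sym; apply/negP => /eqP Wx.
  suff /FZ Fx0 : x \in Z by rewrite Fx0 ltxx in Fx.
  apply: KV => // i; apply/eqP; move: Wx => /eqP; rewrite ev_sum psumr_eq0.
    by move=> /allP/(_ i); rewrite mem_index_enum /= evXn sqrf_eq0 => ->.
  by move=> j _; rewrite evXn sqr_ge0.
have [L L0 [KL _]] := polytope_ball qM Mg Kr Kx0.
have [B B0 hB] := cube_bounded L W.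
have WN x : K x -> ev x W < B + 1.
  by move=> Kx;
    rewrite (le_lt_trans (ler_norm _)) // (le_lt_trans (hB x (KL x Kx))) // ltrDl.
have N0 : 0 < B + 1 by rewrite ltr_wpDl.
(* Over all pairs, (V_i + V_j)^2 + (V_i - V_j)^2 adds up to 4 #|T| W, while the difference of the
   two squares is only 4 V_i V_j; hence the factor #|T| on [o]. *)
pose th (e : R) (p : T * T) := d + C (e * #|T|%:R) * o p.1 p.2.
have thZ e p x : K x -> ev x F <= 0 -> 0 < ev x (th e p).
  move=> Kx Fx; have /doZ[dx ox] : x \in Z.
    by apply: ZF => //; apply/eqP; rewrite eq_le Fx F0.
  by rewrite evD evM ox mulr0 addr0.
have /choice[k1 hk1] := fun p => peak_pos qM Mg Kr Kx0 F0 (fun x _ => W0 x) FW (thZ 1 p) WN N0.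
have /choice[k2 hk2] := fun p => peak_pos qM Mg Kr Kx0 F0 (fun x _ => W0 x) FW (thZ (-1) p) WN N0.
(* One k serves all pairs and both signs, because A and q are common to them. *)
pose k := maxn (\max_p k1 p) (\max_p k2 p).
have k1k p : (k1 p <= k)%N by rewrite leq_max leq_bigmax.
have k2k p : (k2 p <= k)%N by rewrite leq_max leq_bigmax orbT.
have M1 p := putinar qM Mg Kr Kx0 (hk1 p k (k1k p)).
have M2 p := putinar qM Mg Kr Kx0 (hk2 p k (k2k p)).
set A := peak _ _ _ in M1 M2; set q := peak_quo _ _ _ in M1 M2.
have AE : 1 - A ^+ 2 = W * q by exact: peakE.
have nT : #|T|%:R != 0 :> R by rewrite pnatr_eq0 -lt0n.
pose c := C (4 * #|T|%:R)^-1.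
have c1 : c * C #|T|%:R * 4 = 1.
  rewrite -(mpolyC_nat n R 4) -!mpolyCM -mulrA [#|T|%:R * 4]mulrC mulVf ?mpolyC1 //.
  by rewrite mulf_neq0.
have -> : F = A ^+ 2 * m + \sum_i \sum_j (c * ((V i + V j) ^+ 2 *
    (q * F + A ^+ 2 * th 1 (i, j)) + (V i - V j) ^+ 2 * (q * F + A ^+ 2 * th (-1) (i, j)))).
  have sE : \sum_i \sum_j (c * ((V i + V j) ^+ 2 *
    (q * F + A ^+ 2 * th 1 (i, j)) + (V i - V j) ^+ 2 * (q * F + A ^+ 2 * th (-1) (i, j)))) =
    2 * c * (q * F + A ^+ 2 * d) * (\sum_i \sum_j (V i ^+ 2 + V j ^+ 2))
     + (c * C #|T|%:R * 4) * A ^+ 2 * \sum_i \sum_j V i * V j * o i j.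
    rewrite !mulr_sumr -big_split /=; apply: eq_bigr => i _.
    rewrite !mulr_sumr -big_split /=; apply: eq_bigr => j _.
    by rewrite /th /= mul1r mulN1r mpolyCN; ring.
  have sW : \sum_i \sum_j (V i ^+ 2 + V j ^+ 2) = 2 * C #|T|%:R * W.
    under eq_bigr do rewrite big_split /= sumr_const -[_ *+ _]mulr_natl.
    rewrite big_split /= -mulr_sumr -/W sumr_const -[_ *+ _]mulr_natl.
    by rewrite -(mpolyC_nat n R #|T|); ring.
  have oE : \sum_i \sum_j V i * V j * o i j = F - m - W * d.
    by rewrite {1}FE -mulr_suml -/W; ring.
  rewrite sE sW oE;
    transitivity (A ^+ 2 * m + (c * C #|T|%:R * 4) * ((W * q) * F + A ^+ 2 * F - A ^+ 2 * m)).
    by rewrite c1 -AE; ring.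
  by ring.
apply: (qmoduleD qM); first exact: qmodule_sqrM.
apply: qmodule_sum => // i _; apply: qmodule_sum => // j _.
have c0 : 0 <= (4 * #|T|%:R)^-1 :> R by rewrite invr_ge0 mulr_ge0.
apply: (qmoduleZ qM c0); apply: (qmoduleD qM); apply: (qmodule_sqrM qM).
  exact: (M1 (i, j)).
exact: (M2 (i, j)).
Qed.

End Local.

(** * The certificate at a single zero *)

Section Vertex.
Variables (R : realType) (n : nat).
Local Notation P := {mpoly R[n]}.
Local Notation C := (@mpolyC n R).
Local Notation X := (fun s : 'I_n => @mpolyX n R (mnm1 s)).

Lemma dot_scaler (v x : 'rV[R]_n) t : dot v (t *: x) = t * dot v x.
Proof. by rewrite /dot mulr_sumr; apply: eq_bigr => s _; rewrite mxE; ring. Qed.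

Lemma dot_addr (v x y : 'rV[R]_n) : dot v (x + y) = dot v x + dot v y.
Proof. by rewrite -[x in LHS]scale1r functional_dot mul1r. Qed.

Lemma dot_oppl (v x : 'rV[R]_n) : dot (- v) x = - dot v x.
Proof. by rewrite /dot -sumrN; apply: eq_bigr => s _; rewrite mxE; ring. Qed.

(* If v is positive on a cone minus the origin, each 0 <= ± x_s follows from the
   constraints of the cone together with - v >= 0; adding up the resulting Farkas
   certificates gives one of v in which every constraint that is needed to
   generate the coordinates has a positive coefficient. *)
Lemma farkas_pointed (J : finType) (w : J -> 'rV[R]_n) (v : 'rV[R]_n) :
  (forall x, (forall j, 0 <= dot (w j) x) -> x != 0 -> 0 < dot v x) ->
  exists (c : J -> R) (be : 'I_n -> J -> R),
    [/\ forall j, 0 <= c j, v = \sum_j c j *: w j,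
        forall s, delta_mx ord0 s = \sum_j be s j *: w j
      & forall j, c j = 0 -> forall s, be s j = 0].
Proof.
move=> vpos.
have [x wx|c0 c0p vE] := @farkas_lin R n J w v.
  have [->|x0] := eqVneq x 0; last by rewrite ltW // vpos.
  by rewrite functional0 //; exact: functional_dot.
(* The pair p = (s, e) stands for the form (-1)^e x_s, and [la.2] is the multiplier of - v. *)
have ex (p : 'I_n * bool) : exists la : (J -> R) * R, [/\ forall j, 0 <= la.1 j, 0 <= la.2
    & (-1) ^+ p.2 *: delta_mx ord0 p.1 = \sum_j la.1 j *: w j - la.2 *: v].
  pose w' o := if o is Some j then w j else - v.
  have [x wx|la la0] := @farkas_lin R n _ w' ((-1) ^+ p.2 *: delta_mx ord0 p.1).
    have -> : x = 0.
      apply/eqP; apply: contraT => x0.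
      have /vpos/(_ x0) : forall j, 0 <= dot (w j) x by move=> j; exact: (wx (Some j)).
      by have := wx None; rewrite /= dot_oppl; lra.
    by rewrite functional0 //; exact: functional_dot.
  rewrite (bigD1 None) //= (reindex_omap Some id) /=; last by case.
  move=> E; exists (la \o Some, la None); split => [j||] /=; [exact: la0|exact: la0|].
  rewrite E scalerN addrC; congr (_ - _); apply: eq_bigl => j; exact: eqxx.
have {ex} /choice[la hla] := ex.
pose D := 1 + \sum_p (la p).2.
have D0 : 0 < D by rewrite ltr_pwDl // sumr_ge0 // => p _; case: (hla p).
(* Over both signs the left-hand sides cancel, so the sum of the [la.2] times v is a combination
   with coefficients the sums of the [la.1]. Adding v = Σ c0_j w_j and dividing by [D] keeps every
   [la.1] visible in [c]. *)
pose c j := D^-1 * (c0 j + \sum_p (la p).1 j).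
have laj p j : 0 <= (la p).1 j by case: (hla p).
have cp j : 0 <= c j.
  by rewrite mulr_ge0 ?invr_ge0 ?(ltW D0) // addr_ge0 // sumr_ge0.
have vc : v = \sum_j c j *: w j.
  have E : \sum_p (\sum_j (la p).1 j *: w j - (la p).2 *: v) = 0.
    under eq_bigr => p _ do (have [_ _ <-] := hla p).
    have -> : \sum_(p : 'I_n * bool) (-1) ^+ p.2 *: delta_mx ord0 p.1 =
        \sum_s \sum_e (-1) ^+ nat_of_bool e *: delta_mx ord0 s :> 'rV[R]_n.
      by rewrite pair_bigA.
    rewrite big1 // => s _.
    by rewrite big_bool expr0 expr1 scaleN1r scale1r; exact: addNr.
  have DvE : D *: v = \sum_j (c0 j + \sum_p (la p).1 j) *: w j.
    rewrite /D scalerDl scale1r scaler_suml {1}vE.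
    under [RHS]eq_bigr do rewrite scalerDl scaler_suml.
    rewrite big_split exchange_big /=; congr (_ + _).
    by apply/eqP; rewrite eq_sym -subr_eq0 -sumrB E.
  under eq_bigr do rewrite /c -scalerA.
  by rewrite -scaler_sumr -DvE scalerA mulVf ?scale1r // gt_eqF.
(* v is eliminated from the certificate of x_s by means of v = Σ c_j w_j. *)
exists c, (fun s j => (la (s, false)).1 j - (la (s, false)).2 * c j).
split => // [s|j cj s].
  case: (hla (s, false)) => _ _; rewrite /= expr0 scale1r => ->.
  under [RHS]eq_bigr do rewrite scalerBl -scalerA.
  by rewrite sumrB -scaler_sumr -vc.
rewrite cj mulr0 subr0; apply/eqP; rewrite eq_le laj andbT.
have := cj; rewrite /c => /eqP; rewrite mulf_eq0 invr_eq0 gt_eqF //=.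
rewrite (bigD1 (s, false)) //= => /eqP h.
have : 0 <= \sum_(p | p != (s, false)) (la p).1 j by rewrite sumr_ge0.
by have := c0p j; lra.
Qed.

Variables (J : finType) (al : J -> R) (u : J -> 'rV[R]_n).
Let g j := aff (al j) (u j).
Local Notation K := (polytope al u).
Variables (M : P -> Prop) (qM : qmodule M) (Mg : forall j, M (g j)).

(** Inactive constraints have positive slack, and t is small against all their ratios [e j]; for
    active ones [e j] is 0, as division by 0 yields 0. *)
Lemma polytope_direction (z h : 'rV[R]_n) : K z ->
  (forall j, ev z (g j) = 0 -> 0 <= dot (u j) h) ->
  exists2 t, 0 < t & K (z + t *: h).
Proof.
move=> Kz zh.
pose e j := `|dot (u j) h| / ev z (g j).
have e0 j : 0 <= e j by rewrite divr_ge0 // Kz.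
pose t := (1 + \sum_j e j)^-1.
have t0 : 0 < t by rewrite invr_gt0 ltr_pwDl // sumr_ge0.
exists t => // j.
have -> : ev (z + t *: h) (aff (al j) (u j)) = ev z (g j) + t * dot (u j) h.
  by rewrite !ev_aff dot_addr dot_scaler addrA.
have [gj|gj] := eqVneq (ev z (g j)) 0.
  by rewrite gj add0r mulr_ge0 ?(ltW t0) // zh.
have gj0 : 0 < ev z (g j) by rewrite lt_neqAle eq_sym gj Kz.
have : t * `|dot (u j) h| <= ev z (g j).
  rewrite ler_pdivrMl; last by rewrite ltr_pwDl // sumr_ge0.
  rewrite -ler_pdivrMr // -/(e j) (bigD1 j) //= addrCA lerDl.
  by rewrite addr_ge0 // sumr_ge0.
have := ler_norm (- dot (u j) h); rewrite normrN => /(ler_wpM2l (ltW t0)).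
by rewrite mulrN; lra.
Qed.

(** With G_j the active constraints and h = X - z, F is rearranged as Σ (c_j + p_j) G_j + Σ h_s^2
    with p_j(z) = 0. Completing the square in c_j + p_j leaves - Σ p_j^2 G_j / (4 c_j), a quadratic
    form in h whose coefficients vanish at z because G_j does. Where c_j = 0, also p_j = 0. *)
Lemma quadratic_at_vertex (F : P) (z : 'rV[R]_n) (Y : 'I_n -> P) : K z ->
  F = \sum_s (X s - C (z ord0 s)) * Y s ->
  (forall x, K x -> x != z ->
     0 < \sum_s (x ord0 s - z ord0 s) * ev z (Y s)) ->
  quadratic_at al u M F [:: z].
Proof.
move=> Kz FE vpos.
pose v : 'rV[R]_n := \row_s ev z (Y s).
pose act j := ev z (g j) == 0.
pose w j := if act j then u j else 0.
have [x wx x0|c [be [c0 vE dE cbe]]] := @farkas_pointed J w v.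
  have [j /eqP gj|t t0 Kt] := @polytope_direction z x Kz.
    by have := wx j; rewrite /w /act gj.
  have := vpos _ Kt; rewrite -subr_eq0 addrAC subrr add0r scaler_eq0 negb_or x0 gt_eqF //.
  move=> /(_ isT); rewrite (_ : \sum_s _ = t * dot v x) ?pmulr_rgt0 //.
  rewrite /dot mulr_sumr; apply: eq_bigr => s _.
  by rewrite !mxE; ring.
pose h s := X s - C (z ord0 s).
pose G j := if act j then g j else 0.
have MG j : M (G j) by rewrite /G; case: ifP => _; [exact: Mg|exact: qmodule0 qM].
have Gz j : ev z (G j) = 0 by rewrite /G; case: ifP => [/eqP//|_]; exact: ev0.
have GE j : G j = lin (w j) - C (dot (w j) z).
  rewrite /G /w /act; case: ifP => [/eqP gz|_].
    by move: gz; rewrite /g ev_aff /aff => /eqP; rewrite addr_eq0 => /eqP ->;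
      rewrite mpolyCN addrC.
  rewrite /lin /dot !big1 => [|s _|s _]; first by rewrite mpolyC0 subr0.
    by rewrite mxE mul0r.
  by rewrite mxE mpolyC0 mul0r.
have Gcomb (d : J -> R) : \sum_j C (d j) * G j = lin (\sum_j d j *: w j) - C (dot (\sum_j d j *: w j) z).
  rewrite lin_sum dot_suml rmorph_sum -sumrB; apply: eq_bigr => j _ /=.
  by rewrite GE mpolyCM; ring.
have linh (q : 'rV[R]_n) : lin q - C (dot q z) = \sum_s C (q ord0 s) * h s.
  rewrite /lin /dot rmorph_sum -sumrB; apply: eq_bigr => s _ /=.
  by rewrite /h mpolyCM; ring.
have hG s : h s = \sum_j C (be s j) * G j.
  rewrite Gcomb -dE linh (bigD1 s) //= big1 => [|i /negPf is_]; rewrite mxE ?eqxx /=.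
    by rewrite mpolyC1; ring.
  by rewrite is_ mpolyC0 mul0r.
have vG : \sum_s C (ev z (Y s)) * h s = \sum_j C (c j) * G j.
  by rewrite Gcomb -vE linh; apply: eq_bigr => s _; rewrite mxE.
have /choice[YY YYE] : forall s, exists YY, Y s = C (ev z (Y s)) + \sum_t h t * YY t.
  by move=> s; exact: hadamard.
(* The term - be_tj compensates for the added Σ h_t^2, which equals Σ_j G_j Σ_t be_tj h_t. *)
pose W j t := \sum_s C (be s j) * YY s t - C (be t j).
pose pj j := \sum_t h t * W j t.
have cW j : c j = 0 -> pj j = 0.
  move=> cj; rewrite /pj big1 // => t _; rewrite /W (cbe j cj) mpolyC0 subr0.
  by rewrite big1 ?mulr0 // => s _; rewrite (cbe j cj) mpolyC0 mul0r.
pose sg j := C (c j) * (1 + C (2 * c j)^-1 * pj j) ^+ 2.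
have sgE j : sg j = C (c j) + pj j + C (4 * c j)^-1 * pj j ^+ 2.
  rewrite /sg; have [cj|cj] := eqVneq (c j) 0.
    by rewrite cW // cj mpolyC0; ring.
  have e1 : C (c j) * C (2 * c j)^-1 * 2 = 1.
    rewrite -(mpolyC_nat n R 2) -!mpolyCM (_ : _ * 2%:R = 1) ?mpolyC1 //.
    by field.
  have e2 : C (4 * c j)^-1 = C (c j) * C (2 * c j)^-1 ^+ 2.
    rewrite [_ ^+ 2]expr2 -!mpolyCM; congr C; by field.
  rewrite e2; transitivity (C (c j) + (C (c j) * C (2 * c j)^-1 * 2) * pj j +
     C (c j) * C (2 * c j)^-1 ^+ 2 * pj j ^+ 2); first by ring.
  by rewrite e1 mul1r.
exists ('I_n : finType), h, (\sum_j sg j * G j), 1,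
  (fun s t => - \sum_j C (4 * c j)^-1 * G j * W j s * W j t).
split.
- apply: qmodule_sum => // j _; apply: (qmodule_sosM qM) => //.
  by apply: issosM; [exact: issosC|exact: issos_sqr].
- have FE2 : F = \sum_j C (c j) * G j + \sum_j (pj j * G j) + \sum_s h s ^+ 2.
    have -> : \sum_s h s ^+ 2 = \sum_j G j * \sum_t C (be t j) * h t.
      under [RHS]eq_bigr do rewrite mulr_sumr.
      rewrite exchange_big /=; apply: eq_bigr => s _.
      rewrite expr2 {1}hG mulr_suml; apply: eq_bigr => j _; ring.
    rewrite -addrA -big_split /= -vG.
    have -> : \sum_j (pj j * G j + G j * \sum_t C (be t j) * h t) =
       \sum_j G j * \sum_t h t * \sum_s C (be s j) * YY s t.
      apply: eq_bigr => j _; rewrite [pj j * _]mulrC -mulrDr; congr (_ * _).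
      rewrite /pj -big_split /=; apply: eq_bigr => t _; rewrite /W; ring.
    rewrite {1}FE.
    under eq_bigr => s _ do rewrite YYE mulrDr -/(h s) [h s * C _]mulrC.
    rewrite big_split /=; congr (_ + _).
    under eq_bigr => s _ do rewrite {1}hG mulr_suml.
    rewrite exchange_big /=; apply: eq_bigr => j _.
    under [in RHS]eq_bigr do rewrite mulr_sumr.
    rewrite [in RHS]exchange_big /= mulr_sumr; apply: eq_bigr => s _.
    rewrite [C _ * _]mulrC -!mulrA; congr (_ * _).
    by rewrite mulr_sumr; apply: eq_bigr => t _; ring.
  have o_E : \sum_s \sum_t h s * h t * - (\sum_j C (4 * c j)^-1 * G j * W j s * W j t) =
      - \sum_j C (4 * c j)^-1 * pj j ^+ 2 * G j.
    under eq_bigr => s _ do under eq_bigr => t _ do rewrite mulrN mulr_sumr.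
    under eq_bigr do rewrite sumrN.
    rewrite sumrN; congr (- _).
    under eq_bigr do rewrite exchange_big /=.
    rewrite exchange_big /=; apply: eq_bigr => j _.
    rewrite /pj expr2 big_distrlr /= mulr_sumr mulr_suml; apply: eq_bigr => s _.
    by rewrite mulr_sumr mulr_suml; apply: eq_bigr => t _; ring.
  rewrite o_E; under [X in _ = _ + X - _]eq_bigr do rewrite mulr1.
  under [X in _ = X + _ - _]eq_bigr do rewrite sgE 2![(_ + _) * G _]mulrDl.
  by rewrite !big_split /= {1}FE2; ring.
- move=> t; rewrite inE => /eqP ->; rewrite ev1; split => // i j.
  by rewrite evN ev_sum big1 ?oppr0 // => k _; rewrite !evM Gz; ring.
- move=> x _ hx; rewrite inE; apply/eqP/rowP => s; have := hx s.
  by rewrite evB evX evC => /eqP; rewrite subr_eq0 => /eqP.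
- move=> y yz; exists 1%N; have [Yy yE] := hadamard z y; exists Yy.
  by rewrite expr1 {1}yE yz ?mem_head // mpolyC0 add0r.
Qed.

End Vertex.

(** * Gluing over all zeros, and limits along segments *)

Section Certificate.
Variables (R : realType) (n : nat).
Local Notation P := {mpoly R[n]}.
Local Notation C := (@mpolyC n R).
Local Notation X := (fun s : 'I_n => @mpolyX n R (mnm1 s)).
Variables (J : finType) (al : J -> R) (u : J -> 'rV[R]_n).
Local Notation K := (polytope al u).
Variables (M : P -> Prop) (r : R) (x0 : 'rV[R]_n).
Hypotheses (qM : qmodule M) (Mg : forall j, M (aff (al j) (u j))).
Hypotheses (Kr : forall x, K x -> cube r x) (Kx0 : K x0).

(** The local certificates are glued one zero at a time. The derivative condition is required of
    every expansion [Y], because [hadamard] only asserts that one exists. *)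
Theorem nonneg_qmodule (F : P) (Z : seq 'rV[R]_n) :
  (forall x, K x -> 0 <= ev x F) ->
  (forall x, x \in Z <-> K x /\ ev x F = 0) ->
  (forall z Y, z \in Z -> F = \sum_s (X s - C (z ord0 s)) * Y s ->
    forall x, K x -> x != z ->
      0 < \sum_s (x ord0 s - z ord0 s) * ev z (Y s)) ->
  M F.
Proof.
move=> F0 ZF vert.
have qZ : forall Z', uniq Z' -> {subset Z' <= Z} -> quadratic_at al u M F Z'.
  elim=> [|z Z' IH]; first by move=> _ _; exact: quadratic_at_nil.
  rewrite cons_uniq => /andP[zZ' uZ'] sZ.
  have zZ : z \in Z by rewrite sZ ?mem_head.
  have [Kz Fz] := (ZF z).1 zZ.
  rewrite -cat1s; apply: (quadratic_at_cat qM).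
  - have [Y FE] := hadamard z F; rewrite Fz mpolyC0 add0r in FE.
    exact: (quadratic_at_vertex qM Mg Kz FE (vert z Y zZ FE)).
  - by apply: IH => // t tZ'; rewrite sZ // inE tZ' orbT.
  - by move=> t; rewrite inE => /eqP ->.
  - by move=> t; rewrite cat1s => /sZ/ZF.
apply: (quadratic_at_qmodule qM Mg Kr Kx0 (qZ (undup Z) (undup_uniq Z) _)) => //.
- by move=> t; rewrite mem_undup.
- by move=> t; rewrite mem_undup => /ZF[].
- by move=> x Kx Fx; rewrite mem_undup; apply/ZF.
Qed.

(** Continuity at the end of a segment; it allows a factor t to be cancelled from an identity before
    t is set to 0. *)
Lemma ev_segment_limit (z h : 'rV[R]_n) (p : P) c :
  (forall t, 0 < t -> t <= 1 -> ev (z + t *: h) p = c) -> ev z p = c.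
Proof.
move=> pc; have [Y pE] := hadamard z p.
pose q := \sum_s C (h ord0 s) * Y s.
have E t : ev (z + t *: h) p = ev z p + t * ev (z + t *: h) q.
  rewrite {1}pE evD evC !ev_sum mulr_sumr; congr (_ + _).
  by apply: eq_bigr => s _; rewrite !evE !mxE; ring.
pose N := \sum_s (`|z ord0 s| + `|h ord0 s|).
have [B B0 qB] := cube_bounded N q.
have hN t : 0 < t -> t <= 1 -> cube N (z + t *: h).
  move=> t0 t1 s; rewrite !mxE (le_trans (ler_normD _ _)) // /N (bigD1 s) //=.
  apply: ler_wpDr; first by apply: sumr_ge0 => i _; exact: addr_ge0.
  by rewrite lerD // normrM (gtr0_norm t0) ler_piMl.
apply/eqP; rewrite -subr_eq0 -normr_eq0; apply: contraT => d0.
pose d := `|ev z p - c|.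
have dp : 0 < d by rewrite lt_neqAle eq_sym d0 /= normr_ge0.
(* For this t one has t B < d, whereas the expansion at z gives d <= t B. *)
pose t := d / (d + B + 1).
have D0 : 0 < d + B + 1 by rewrite ltr_pwDr // addr_ge0 // ltW.
have t0 : 0 < t by rewrite divr_gt0.
have t1 : t <= 1 by rewrite ler_pdivrMr // mul1r -addrA lerDl addr_ge0.
have : d <= t * B.
  have := E t; rewrite pc // => cE; rewrite /d cE opprD addrA subrr add0r normrN normrM.
  by rewrite (gtr0_norm t0) ler_wpM2l ?(ltW t0) //; exact: qB (hN t t0 t1).
rewrite /t mulrAC ler_pdivlMr // ler_pM2l //; lra.
Qed.

End Certificate.

(** * Multilinear functions on products of polytopes *)

Section Blocks.
Variables (R : realType) (l : nat) (d : 'I_l -> nat).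
Local Notation n := (\sum_i d i)%N.
Local Notation C := (@mpolyC n R).
Local Notation X := (fun s : 'I_n => @mpolyX n R (mnm1 s)).

Definition vec (x : bpoint R d) : 'rV[R]_n :=
  \row_k x (tagnat.sig1 k) (tagnat.sig2 k) ord0.

Definition unvec (v : 'rV[R]_n) : bpoint R d :=
  fun i => \col_j v ord0 (tagnat.Rank i j).

Lemma vecK : cancel vec unvec.
Proof.
move=> x; apply: functional_extensionality_dep => i; apply/colP => j.
by rewrite !mxE /tagnat.sig2 /tagnat.sig1 /tagnat.Rank tagnat.rankK.
Qed.

Lemma unvecK : cancel unvec vec.
Proof. by move=> v; apply/rowP => k; rewrite !mxE tagnat.sig2K. Qed.

Lemma beval_vec (x : bpoint R d) p : beval x p = ev (vec x) p.
Proof. by rewrite /beval /ev; apply: meval_eq => k; rewrite mxE. Qed.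

Lemma beval_bvar (x : bpoint R d) i (j : 'I_(d i)) :
  beval x (bvar R j) = x i j ord0.
Proof. by rewrite beval_vec evX -[in RHS](vecK x) [RHS]mxE. Qed.

Definition block_row (i : 'I_l) (k : nat) (M : 'M[R]_(k, d i)) (j : 'I_k) :
  'rV[R]_n := \sum_s M j s *: delta_mx ord0 (tagnat.Rank i s).

Lemma residualE (i : 'I_l) (k : nat) (c : 'cV[R]_k) (M : 'M[R]_(k, d i)) j :
  residual c M j = aff (c j ord0) (- block_row M j).
Proof.
have -> : - block_row M j = \sum_s (- M j s) *: delta_mx ord0 (tagnat.Rank i s).
  by rewrite -sumrN; apply: eq_bigr => s _; rewrite scaleNr.
rewrite /residual /aff lin_sum -sumrN; congr (_ + _); apply: eq_bigr => s _.
by rewrite lin_delta mpolyCN mulNr.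
Qed.

Lemma beval_residual (x : bpoint R d) (i : 'I_l) (k : nat) (c : 'cV[R]_k)
    (M : 'M[R]_(k, d i)) j :
  beval x (residual c M j) = c j ord0 - (M *m x i) j ord0.
Proof.
rewrite beval_vec /residual evB evC ev_sum mxE; congr (_ - _).
by apply: eq_bigr => s _; rewrite evM evC -beval_vec beval_bvar.
Qed.

Definition shift_block (z x : bpoint R d) (i : 'I_l) (t : R) : bpoint R d :=
  fun k => z k + (if k == i then t else 0) *: (x k - z k).

Lemma shift_block0 z x i : shift_block z x i 0 = z.
Proof.
apply: functional_extensionality_dep => k.
by rewrite /shift_block if_same scale0r addr0.
Qed.

(** A monomial of a tensor form on L contains exactly one coordinate of block i if i is in L and
    none otherwise, so it is affine in t. *)
Lemma multilinear_shift (f : blockpoly R d) z x i : multilinear f ->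
  forall t, beval (shift_block z x i t) f =
    beval z f + t * (beval (shift_block z x i 1) f - beval z f).
Proof.
move=> [Q [-> _]] t; rewrite -{2 4}(shift_block0 z x i) !beval_vec.
rewrite !ev_sum -sumrB mulr_sumr -big_split /=; apply: eq_bigr => L _.
rewrite /tensor_form !ev_sum -sumrB mulr_sumr -big_split /=.
apply: eq_bigr => ix _; rewrite !evM !evC.
have pE t' : ev (vec (shift_block z x i t')) (\prod_(k : {k | k \in L}) bvar R (ix k)) =
    \prod_(k : {k | k \in L}) (shift_block z x i t') (val k) (ix k) ord0.
  by rewrite /ev rmorph_prod; apply: eq_bigr => k _;
    exact: (etrans (esym (beval_vec _ _)) (beval_bvar _ _)).
rewrite !pE; have [iL|iL] := boolP (i \in L); last first.
  have cE t' : \prod_(k : {k | k \in L}) (shift_block z x i t') (val k) (ix k) ord0 =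
      \prod_(k : {k | k \in L}) z (val k) (ix k) ord0.
    apply: eq_bigr => -[k kL] _; rewrite /shift_block /=; case: eqP => [ki|_].
      by rewrite -ki kL in iL.
    by rewrite scale0r addr0.
  by rewrite !cE; ring.
pose k0 : {k | k \in L} := Sub i iL.
rewrite !(bigD1 (P := xpredT) k0) //=.
have cE t' : \prod_(k : {k | k \in L} | k != k0) (shift_block z x i t') (val k) (ix k) ord0 =
    \prod_(k : {k | k \in L} | k != k0) z (val k) (ix k) ord0.
  apply: eq_bigr => -[k kL] kk0; rewrite /shift_block /=; case: eqP => [ki|_].
    by case/negP: kk0; apply/eqP/val_inj.
  by rewrite scale0r addr0.
rewrite !cE /shift_block /= eqxx !mxE; ring.
Qed.

Lemma vec_shift z x i t : vec (shift_block z x i t) =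
  vec z + t *: (vec (shift_block z x i 1) - vec z).
Proof.
by apply/rowP => k; rewrite !mxE; case: eqP => _; ring.
Qed.

End Blocks.

(** * The quadratic module QM + I and its truncations *)

Section Constraints.
Variables (R : realType) (l : nat) (d m n : 'I_l -> nat).
Variables (a : forall i, 'cV[R]_(m i)) (A : forall i, 'M[R]_(m i, d i)).
Variables (b : forall i, 'cV[R]_(n i)) (B : forall i, 'M[R]_(n i, d i)).
Local Notation D := (\sum_i d i)%N.
Local Notation P := {mpoly R[D]}.
Local Notation C := (@mpolyC D R).
Local Notation X := (fun s : 'I_D => @mpolyX D R (mnm1 s)).
Local Notation M := (sumset (QM a A) (Iid b B)).

(* each equality constraint is a pair of opposite inequalities *)
Definition constraint : finType :=
  ({i : 'I_l & 'I_(m i)} + {i : 'I_l & 'I_(n i)} * bool)%type.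

Definition constraint_cst (j : constraint) : R :=
  match j with
  | inl p => a (tag p) (tagged p) ord0
  | inr (p, e) => (-1) ^+ e * b (tag p) (tagged p) ord0
  end.

Definition constraint_row (j : constraint) : 'rV[R]_D :=
  match j with
  | inl p => - block_row (A (tag p)) (tagged p)
  | inr (p, e) => (-1) ^+ e *: - block_row (B (tag p)) (tagged p)
  end.

Local Notation g j := (aff (constraint_cst j) (constraint_row j)).
Local Notation K := (polytope constraint_cst constraint_row).

Lemma constraint_eq p e : g (inr (p, e)) =
  C ((-1) ^+ e) * residual (b (tag p)) (B (tag p)) (tagged p).
Proof.
by rewrite residualE /aff /= lin_scale mpolyCM mulrDr.
Qed.

Lemma polytope_feasible (x : bpoint R d) : K (vec x) <-> feasible a A b B x.
Proof.
split=> [Kx i|fx [p|[p e]]].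
- split=> [|j].
    apply/colP => j; have := Kx (inr (Tagged _ j, false));
      have := Kx (inr (Tagged _ j, true)).
    rewrite !constraint_eq !evM !evC -!beval_vec !beval_residual /= expr0 expr1.
    by move=> ? ?; apply/eqP; rewrite eq_le; apply/andP; split; lra.
  by have := Kx (inl (Tagged _ j));
    rewrite /= -residualE -beval_vec beval_residual subr_ge0.
- have [_ /(_ (tagged p))] := fx (tag p).
  by rewrite -residualE -beval_vec beval_residual subr_ge0.
- rewrite constraint_eq evM evC -beval_vec beval_residual.
  by have [<- _] := fx (tag p); rewrite subrr mulr0.
Qed.

Lemma sum_block0 (k : 'I_l -> nat) (f : forall i, 'I_(k i) -> P) :
  (forall i j, f i j = 0) -> \sum_i \sum_(j < k i) f i j = 0.
Proof. by move=> f0; apply: big1 => i _; apply: big1 => j _. Qed.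

Lemma QM_add p q : QM a A p -> QM a A q -> QM a A (p + q).
Proof.
move=> [s0 [s [h0 h ->]]] [t0 [t [g0 g ->]]].
exists (s0 + t0), (fun i j => s i j + t i j); split.
- exact: issosD.
- by move=> i j; exact: issosD (h i j) (g i j).
- rewrite addrACA; congr (_ + _); rewrite -big_split; apply: eq_bigr => i _ /=.
  by rewrite -big_split; apply: eq_bigr => j _ /=; rewrite mulrDl.
Qed.

Lemma QM_mul q p : issos q -> QM a A p -> QM a A (q * p).
Proof.
move=> hq [s0 [s [h0 h ->]]].
exists (q * s0), (fun i j => q * s i j); split.
- exact: issosM.
- by move=> i j; exact: issosM (h i j).
- rewrite mulrDr mulr_sumr; congr (_ + _); apply: eq_bigr => i _ /=.
  by rewrite mulr_sumr; apply: eq_bigr => j _; rewrite mulrA.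
Qed.

Lemma I_add p q : Iid b B p -> Iid b B q -> Iid b B (p + q).
Proof.
move=> [s [_ ->]] [t [_ ->]]; exists (fun i j => s i j + t i j); split => //.
rewrite -big_split; apply: eq_bigr => i _ /=.
by rewrite -big_split; apply: eq_bigr => j _ /=; rewrite mulrDl.
Qed.

Lemma I_mul q p : Iid b B p -> Iid b B (q * p).
Proof.
move=> [s [_ ->]]; exists (fun i j => q * s i j); split => //.
rewrite mulr_sumr; apply: eq_bigr => i _ /=.
by rewrite mulr_sumr; apply: eq_bigr => j _; rewrite mulrA.
Qed.

Lemma I0 : Iid b B 0.
Proof.
exists (fun _ _ => 0); split => //.
by apply/esym/sum_block0 => i j; rewrite mul0r.
Qed.

Lemma QM1 : QM a A 1.
Proof.
exists 1, (fun _ _ => 0); split.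
- by have := issos_sqr (1 : P); rewrite expr1n.
- by move=> i j; exact: issos0.
- by rewrite [X in _ + X]sum_block0 ?addr0 // => i j; rewrite mul0r.
Qed.

Lemma QM0 : QM a A 0.
Proof. by rewrite -(mul0r 1); apply: QM_mul QM1; exact: issos0. Qed.

Lemma qmodule_sumset : qmodule M.
Proof.
split.
- by exists 1; [exact: QM1|exists 0; [exact: I0|rewrite addr0]].
- move=> p q [x hx [y hy <-]] [x' hx' [y' hy' <-]].
  exists (x + x'); first exact: QM_add.
  by exists (y + y'); [exact: I_add|rewrite addrACA].
- move=> q p [x hx [y hy <-]]; exists (q ^+ 2 * x).
    by apply: QM_mul hx; exact: issos_sqr.
  by exists (q ^+ 2 * y); [exact: I_mul|rewrite mulrDr].
Qed.

Definition block_delta (W : pzRingType) (k : 'I_l -> nat) (p : {i & 'I_(k i)})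
    (c : W) (i : 'I_l) (j : 'I_(k i)) : W :=
  if Tagged (fun i => 'I_(k i)) j == p then c else 0.

Lemma sum_block_delta (W : pzRingType) (k : 'I_l -> nat) (p : {i & 'I_(k i)})
    (c : W) (f : forall i, 'I_(k i) -> W) :
  \sum_i \sum_(j < k i) block_delta p c j * f i j = c * f (tag p) (tagged p).
Proof.
case: p => i0 j0 /=.
rewrite (bigD1 i0) //= [X in _ + X]big1 => [|i ii0]; last first.
  rewrite big1 // => j _; rewrite /block_delta; case: eqP => [E|_]; last by rewrite mul0r.
  by have := congr1 tag E => /= E'; rewrite E' eqxx in ii0.
rewrite (bigD1 j0) //= {1}/block_delta eqxx big1 ?addr0 // => j jj0.
by rewrite /block_delta eq_Tagged /= (negPf jj0) mul0r.
Qed.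

Lemma constraint_sumset j : M (g j).
Proof.
case: j => [p|[p e]].
  exists (g (inl p)); last by exists 0; [exact: I0|rewrite addr0].
  exists 0, (block_delta p 1); split; first exact: issos0.
    move=> i j; rewrite /block_delta; case: ifP => _; last exact: issos0.
    by have := issos_sqr (1 : P); rewrite expr1n.
  by rewrite sum_block_delta mul1r add0r residualE.
exists 0; first exact: QM0.
exists (g (inr (p, e))); last by rewrite add0r.
exists (block_delta p (C ((-1) ^+ e))).
by split => //; rewrite sum_block_delta constraint_eq.
Qed.

Lemma QMt_le t t' : (t <= t')%N -> QMt t a A `<=` QMt t' a A.
Proof.
move=> tt' p [s0 [s [[h0 h0'] h ->]]]; exists s0, s; split => //.
  by split => //; apply: leq_trans h0' _; rewrite ltnS leq_mul2l tt' orbT.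
move=> i j; have [hs hs'] := h i j; split => //.
by apply: leq_trans hs' _; rewrite ltnS leq_sub2r // leq_mul2l tt' orbT.
Qed.

Lemma Iidt_le t t' : (t <= t')%N -> Iidt t b B `<=` Iidt t' b B.
Proof.
move=> tt' p [s [h ->]]; exists s; split => // i j.
by apply: leq_trans (h i j) _; rewrite ltnS leq_sub2r // leq_mul2l tt' orbT.
Qed.

(** A fixed representation has bounded degrees, hence is admissible at every sufficiently high
    level. *)
Lemma sumset_truncation p : M p -> exists t0, forall t, (t0 <= t)%N ->
  sumset (QMt t a A) (Iidt t b B) p.
Proof.
move=> [_ [s0 [s [h0 h ->]]] [_ [tau [_ ->]] <-]].
pose ms := (\sum_i \sum_(j < m i) msize (s i j))%N.
pose mt := (\sum_i \sum_(j < n i) msize (tau i j))%N.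
exists (msize s0 + ms + mt).+1 => t ht.
have le_sum (k : 'I_l -> nat) (f : forall i, 'I_(k i) -> nat) i j :
    (f i j <= \sum_i \sum_(j < k i) f i j)%N.
  by rewrite (bigD1 i) //= (bigD1 j) //= -addnA leq_addr.
have hs i j : (msize (s i j) <= ms)%N := le_sum m (fun i j => msize (s i j)) i j.
have ht' i j : (msize (tau i j) <= mt)%N := le_sum n (fun i j => msize (tau i j)) i j.
clearbody ms mt.
exists (s0 + \sum_i \sum_(j < m i) s i j * residual (a i) (A i) j).
  exists s0, s; split => //.
    by split => //; rewrite /= /degle; move: (msize s0) ht => k; lia.
  move=> i j; split; first exact: h.
  by apply: leq_trans (hs i j) _; move: (msize s0) ht => k; lia.
exists (\sum_i \sum_(j < n i) tau i j * residual (b i) (B i) j) => //.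
exists tau; split => // i j.
by apply: leq_trans (ht' i j) _; move: (msize s0) ht => k; lia.
Qed.

Lemma QMt_QM t : QMt t a A `<=` QM a A.
Proof.
move=> p [s0 [s [[h0 _] h ->]]]; exists s0, s; split => // i j.
by case: (h i j).
Qed.

Lemma Iidt_Iid t : Iidt t b B `<=` Iid b B.
Proof. by move=> p [s [h ->]]; exists s. Qed.

Lemma sumset_ge0 p x : M p -> feasible a A b B x -> 0 <= beval x p.
Proof.
move=> [_ [s0 [s [h0 h ->]]] [_ [tau [_ ->]] <-]] fx.
rewrite beval_vec !evD !ev_sum addr_ge0 ?addr_ge0 //.
- exact: issos_ge0.
- apply: sumr_ge0 => i _; rewrite ev_sum sumr_ge0 // => j _.
  rewrite evM mulr_ge0 //; first exact: issos_ge0 (h i j).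
  by rewrite -beval_vec beval_residual subr_ge0; case: (fx i).
- rewrite big1 // => i _; rewrite ev_sum big1 // => j _.
  rewrite evM -(beval_vec x (residual _ _ _)) beval_residual.
  by have [<- _] := fx i; rewrite subrr mulr0.
Qed.

End Constraints.

(** * Maximizers of a multilinear function *)

Section Maximizers.
Variables (R : realType) (l : nat) (d m n : 'I_l -> nat).
Variables (a : forall i, 'cV[R]_(m i)) (A : forall i, 'M[R]_(m i, d i)).
Variables (b : forall i, 'cV[R]_(n i)) (B : forall i, 'M[R]_(n i, d i)).
Local Notation D := (\sum_i d i)%N.
Local Notation P := {mpoly R[D]}.
Local Notation C := (@mpolyC D R).
Local Notation X := (fun s : 'I_D => @mpolyX D R (mnm1 s)).
Local Notation M := (sumset (QM a A) (Iid b B)).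
Local Notation K := (polytope (constraint_cst a b) (constraint_row A B)).

Lemma polytope_feasible_unvec (x : 'rV[R]_D) : K x <-> feasible a A b B (unvec x).
Proof. by rewrite -{1}(unvecK x); exact: polytope_feasible. Qed.

Lemma feasible_cube :
  (forall i, bounded_set (polyhedron (a i) (A i) (b i) (B i))) ->
  exists r, forall x, K x -> cube r x.
Proof.
move=> bnd.
have /choice[r hr] : forall i, exists r, forall y, polyhedron (a i) (A i) (b i) (B i) y ->
    forall j, `|y j ord0| <= r.
  (* [bounded_set] provides the bounds strictly above [N] only. *)
  move=> i; have [N [_ hN]] := bnd i; exists (N + 1) => y hy j.
  apply: le_trans (hN (N + 1) _ y hy); last by rewrite ltrDl.
  rewrite [leRHS]/Num.norm /= mx_normrE.
  exact: (@le_bigmax _ _ _ 0 (fun p : 'I_(d i) * 'I_1 => `|y p.1 p.2|) (j, ord0)).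
exists (\sum_i `|r i|) => x /polytope_feasible_unvec fx s.
rewrite -(unvecK x) mxE (le_trans (hr _ _ (fx _) _)) //.
rewrite (le_trans (ler_norm _)) // (bigD1 (tagnat.sig1 s)) //= lerDl.
by apply: sumr_ge0 => i _.
Qed.

Lemma feasible_shift (z x : bpoint R d) i t : feasible a A b B z ->
  feasible a A b B x -> 0 <= t <= 1 -> feasible a A b B (shift_block z x i t).
Proof.
move=> fz fx t01 k; rewrite /shift_block; set e := if _ then _ else _.
have {t01} /andP[e0 e1] : 0 <= e <= 1 by rewrite /e; case: ifP; rewrite // lexx ler01.
have [bz az] := fz k; have [bx ax] := fx k.
split => [|j].
  by rewrite /eqspace /= mulmxDr -scalemxAr mulmxBr -bz -bx subrr scaler0 addr0.
rewrite mulmxDr -scalemxAr mulmxBr !mxE.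
have := az j; have := ax j; rewrite !mxE => hx hz.
have := ler_wpM2l e0 hx; have := ler_wpM2l (_ : 0 <= 1 - e) hz.
by rewrite subr_ge0 => /(_ e1); lra.
Qed.

Variables (f : P) (fstar : R) (Z : seq 'rV[R]_D).
Hypothesis hf : multilinear f.
Hypothesis fmax : forall x, K x -> ev x f <= fstar.
Hypothesis ZE : forall x, x \in Z <-> K x /\ ev x (C fstar - f) = 0.

(* Since f is affine in each block, its derivative at a maximizer z in the
   direction of another feasible point is a sum of differences of values of f,
   and by finiteness of the set of maximizers these do not all vanish. *)
Lemma maximizer_derivative (z x : 'rV[R]_D) (Y : 'I_D -> P) : z \in Z ->
  C fstar - f = \sum_s (X s - C (z ord0 s)) * Y s -> K x -> x != z ->
  0 < \sum_s (x ord0 s - z ord0 s) * ev z (Y s).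
Proof.
set F := C fstar - f => zZ FE Kx xz.
have [Kz Fz] := (ZE z).1 zZ.
pose sh i t := vec (shift_block (unvec z) (unvec x) i t).
(* The part of x - z in block i; these parts add up to x - z. *)
pose w i := sh i 1 - z.
have shE i t : sh i t = z + t *: w i by rewrite /sh vec_shift unvecK.
have Ksh i t : 0 <= t <= 1 -> K (z + t *: w i).
  move=> t01; rewrite -shE; apply/polytope_feasible/feasible_shift => //.
    exact/polytope_feasible_unvec.
  exact/polytope_feasible_unvec.
pose c i := ev (sh i 1) F.
have Fsh i t : ev (z + t *: w i) F = t * c i.
  have fz : ev z f = fstar.
    by move: Fz; rewrite evB evC => /eqP; rewrite subr_eq0 => /eqP.
  have := multilinear_shift (unvec z) (unvec x) i hf t.
  rewrite !beval_vec -/(sh i t) -/(sh i 1) unvecK shE fz => fE.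
  by rewrite /c !evB !evC fE; ring.
have c0 i : 0 <= c i.
  by rewrite /c evB evC subr_ge0 fmax // shE; apply: Ksh; rewrite ler01 lexx.
have dE i : \sum_s w i ord0 s * ev z (Y s) = c i.
  have <- : ev z (\sum_s C (w i ord0 s) * Y s) = \sum_s w i ord0 s * ev z (Y s).
    by rewrite ev_sum; apply: eq_bigr => s _; rewrite evM evC.
  (* F is t c_i on the segment; dividing by t and passing to t = 0 gives its derivative along
     [w i]. *)
  apply: (ev_segment_limit (h := w i)) => t t0 t1.
  have := Fsh i t; rewrite FE ev_sum => E.
  have t0' : t != 0 by rewrite gt_eqF.
  apply: (mulfI t0'); rewrite -E ev_sum mulr_sumr; apply: eq_bigr => s _.
  by rewrite !evM evB evX !evC !mxE; ring.
have wsE i s : w i ord0 s = if tagnat.sig1 s == i then x ord0 s - z ord0 s else 0.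
  rewrite /w /sh /vec !mxE !tagnat.sig2K.
  by case: eqP => _; ring.
have wE s : \sum_i w i ord0 s = x ord0 s - z ord0 s.
  under [LHS]eq_bigr do rewrite wsE.
  by rewrite -big_mkcond; apply: big_pred1 => i; exact: eq_sym.
have -> : \sum_s (x ord0 s - z ord0 s) * ev z (Y s) = \sum_i c i.
  under [LHS]eq_bigr do rewrite -wE mulr_suml.
  by rewrite exchange_big; apply: eq_bigr => i _; exact: dE.
have [i wi] : exists i, w i != 0.
  apply: contrapT => /forallNP w0; move/negP: xz; apply; apply/eqP/rowP => s.
  apply/eqP; rewrite -subr_eq0 -wE; apply/eqP/big1 => i _.
  by have /negP/negPn/eqP -> := w0 i; rewrite mxE.
have ci : 0 < c i.
  rewrite lt_neqAle c0 andbT eq_sym; apply/eqP => ci0.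
  (* If c_i = 0, then F vanishes on the whole segment, which contains more distinct points than [Z]
     has entries. *)
  pose p k := z + k.+1%:R^-1 *: w i.
  have pinj : injective p.
    move=> k k' /addrI/eqP; rewrite -subr_eq0 -scalerBl scaler_eq0 (negPf wi) orbF.
    by rewrite subr_eq0 => /eqP/invr_inj/eqP; rewrite eqr_nat eqSS => /eqP.
  have : (size (map p (iota 0 (size Z).+1)) <= size Z)%N.
    apply: uniq_leq_size; first by rewrite (map_inj_uniq pinj) iota_uniq.
    move=> _ /mapP[k _ ->]; apply/ZE; split; last by rewrite Fsh ci0 mulr0.
    by apply: Ksh; rewrite invr_ge0 ler0n invf_le1 ?ltr0n // ler1n.
  by rewrite size_map size_iota ltnn.
by rewrite (bigD1 i) //= ltr_wpDr // sumr_ge0.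
Qed.

End Maximizers.

(** * Convergence and finite convergence of the hierarchy *)

Theorem theorem3p1 (R : realType) (l : nat) (d m n : 'I_l -> nat)
    (a : forall i : 'I_l, 'cV[R]_(m i)) (A : forall i : 'I_l, 'M[R]_(m i, d i))
    (b : forall i : 'I_l, 'cV[R]_(n i)) (B : forall i : 'I_l, 'M[R]_(n i, d i))
    (f : blockpoly R d)
    (hl : (2 <= l)%N)
    (hbounded : forall i : 'I_l, bounded_set (polyhedron (a i) (A i) (b i) (B i)))
    (hrelint : forall i : 'I_l, 
      relint (eqspace (b i) (B i)) (polyhedron (a i) (A i) (b i) (B i)) !=set0)
    (hA : assumptionA a A b B)
    (hf : multilinear f) :
  exists2 fstar : R, ismax (feasible a A b B) (fun x => beval x f) fstar &
    ((forall t : nat, (l <= t)%N -> (fstar%:E <= ft a A b B f t)%E) /\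
     ft a A b B f t @[t --> \oo] --> fstar%:E) /\
    (finite_set [set x | feasible a A b B x /\ beval x f = fstar] ->
      sumset (QM a A) (Iid b B) (cstpoly d fstar - f) /\
      exists2 t0 : nat, (l <= t0)%N &
        forall t : nat, (t0 <= t)%N -> ft a A b B f t = fstar%:E).
Proof.
have qM := qmodule_sumset a A b B; have Mg := @constraint_sumset R l d m n a A b B.
have [r Kr] := feasible_cube hbounded.
have [x0 Kx0] : exists x0, polytope (constraint_cst a b) (constraint_row A B) x0.
  pose x i := sval (cid (hrelint i)).
  exists (vec x); apply/polytope_feasible => i.
  by rewrite /x; case: (cid _) => y [].
have [z Kz zmax] := polytope_max qM Mg Kr Kx0 f.
have fz : beval (unvec z) f = ev z f by rewrite beval_vec unvecK.
have feasz : feasible a A b B (unvec z) by exact/polytope_feasible_unvec.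
have ftE t mu : sumset (QMt t a A) (Iidt t b B) (cstpoly d mu - f) ->
    (ft a A b B f t <= mu%:E)%E.
  by move=> h; apply: ereal_inf_lbound; exists mu.
have ge_ft t : ((ev z f)%:E <= ft a A b B f t)%E.
  apply: le_ereal_inf_tmp => _ [mu [p hp [q hq pq]] <-]; rewrite lee_fin.
  have Mmu : sumset (QM a A) (Iid b B) (cstpoly d mu - f).
    by exists p; [exact: QMt_QM hp|exists q; [exact: Iidt_Iid hq|]].
  have := sumset_ge0 Mmu feasz.
  by rewrite beval_vec evB evC unvecK subr_ge0.
exists (ev z f).
  split; first by exists (unvec z).
  by move=> x fx; rewrite /= beval_vec zmax //; apply/polytope_feasible.
split.
  split=> [t _|]; first exact: ge_ft.
  (* Monotonicity turns the limit into an infimum over all t, the levels below [l] included. *)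
  have ni : {homo ft a A b B f : t t' / (t <= t')%N >-> (t' <= t)%E}.
    move=> t t' tt'; apply: le_ereal_inf_tmp => _ [mu [p hp [q hq pq]] <-].
    apply: ereal_inf_lbound; exists mu => //; exists p; first exact: QMt_le hp.
    by exists q => //; exact: Iidt_le hq.
  have := ereal_nonincreasing_cvgn ni.
  rewrite (_ : ereal_inf _ = (ev z f)%:E) //; apply/eqP; rewrite eq_le; apply/andP; split.
    apply/lee_addgt0Pr => e e0.
    (* f^* + e - f is positive on the polytope, so Putinar's theorem places it at some finite
       level. *)
    have /(putinar qM Mg Kr Kx0)/sumset_truncation[t0 ht0] : forall x,
        polytope (constraint_cst a b) (constraint_row A B) x ->
        0 < ev x (cstpoly d (ev z f + e) - f).
      by move=> x /zmax; rewrite evB evC; lra.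
    apply: (@le_trans _ _ (ft a A b B f t0)); first by apply: ereal_inf_lbound; exists t0.
    by rewrite -EFinD; apply/ftE/ht0.
  by apply: le_ereal_inf_tmp => _ [t _ <-]; exact: ge_ft.
move=> fin.
have [Z ZE] : exists Z : seq 'rV_(\sum_i d i), forall x,
    x \in Z <-> polytope (constraint_cst a b) (constraint_row A B) x /\
      ev x (cstpoly d (ev z f) - f) = 0.
  have /finite_seqP[Z ZE] := finite_image (@vec R l d) fin.
  exists Z => x; have -> : (x \in Z) <-> [set` Z] x by [].
  rewrite -ZE evB evC; split=> [[y [fy yE] <-]|[Kx /eqP]].
    by split; [exact/polytope_feasible|rewrite -beval_vec yE subrr].
  rewrite subr_eq0 => /eqP xE; exists (unvec x); last exact: unvecK.
  by split; [exact/polytope_feasible_unvec|rewrite beval_vec unvecK].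
have MF : sumset (QM a A) (Iid b B) (cstpoly d (ev z f) - f).
  apply: (nonneg_qmodule qM Mg Kr Kx0 _ ZE).
    by move=> x /zmax; rewrite evB evC subr_ge0.
  move=> t Y tZ FE x Kx xt.
  exact: (maximizer_derivative hf zmax ZE tZ FE).
split => //; have [t0 ht0] := sumset_truncation MF.
exists (maxn l t0); first exact: leq_maxl.
move=> t; rewrite geq_max => /andP[_ t0t]; apply/eqP; rewrite eq_le ge_ft andbT.
exact/ftE/ht0.
Qed.
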